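(* Let $p\ge1$ be fixed and let $G$ be a real $p\times n$ matrix (possibly depending on $n$). Suppose that at least one of the following two sets of conditions (A), (B) holds as $n\to\infty$. (A) $W=\mathcal{N}(0,\tau_n^2\Sigma)$ for a sequence $\tau_n>0$ with $\sigma_n=o(\tau_n)$, $\|F_0\|=o(\tau_n^2/\sigma_n)$ and $k_n=o(\tau_n^4/\sigma_n^4)$. (B) $W$ is induced by a distribution $\widetilde W$ on $\theta\in\mathbb{R}^{k_n}$ with Lebesgue density $w$, and there is a sequence $(M_n)_{n\ge1}$ of positive numbers such that (1) $\sup_{\|\Phi h\|^2\le\sigma_n^2M_n,\ \|\Phi g\|^2\le\sigma_n^2M_n}\frac{w(\theta_0+h)}{w(\theta_0+g)}\to1$; (2) $k_n\ln k_n=o(M_n)$; (3) $\max\left(0,\ln\left(\frac{\sqrt{\det(\Phi^T\Phi)}}{\sigma_n^{k_n}w(\theta_0)}\right)\right)=o(M_n)$. Then $$E\left\| W(d(GF)\mid Y)-\mathcal{N}\left(GY_{\langle\phi\rangle},\sigma_n^2G\Sigma G^T\right)\right\|_{\mathrm{TV}}\longrightarrow 0\qquad\text{as } n\to\infty .$$ Further, the distribution of $GY_{\langle\phi\rangle}$ is $\mathcal{N}(GF_{\langle\phi\rangle},\sigma_n^2G\Sigma G^T)$.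
   Context: For every $n\ge1$ one observes $Y=F+\varepsilon\in\mathbb{R}^n$ with $\varepsilon\sim\mathcal{N}(0,\sigma_n^2 I_n)$, where $\sigma_n>0$ is known and may depend on $n$. The true mean vector of $Y$ is $F_0\in\mathbb{R}^n$ (depending on $n$, otherwise arbitrary); $E$ and distributions of functions of $Y$ are taken when $Y\sim\mathcal{N}(F_0,\sigma_n^2I_n)$. Let $\Phi$ be an $n\times k_n$ real matrix of rank $k_n$ with columns the regressors $\phi_1,\dots,\phi_{k_n}$, where $1\le k_n\le n$ and $k_n$ grows with $n$ (in particular $k_n\ge2$ for all large $n$); $\langle\phi\rangle=\{\Phi\theta:\theta\in\mathbb{R}^{k_n}\}$; it is not assumed that $F_0\in\langle\phi\rangle$. Set $\Sigma=\Phi(\Phi^T\Phi)^{-1}\Phi^T$, $Y_{\langle\phi\rangle}=\Sigma Y$, $F_{\langle\phi\rangle}=\Sigma F_0=\Phi\theta_0$, $\theta_0=(\Phi^T\Phi)^{-1}\Phi^TF_0$. A prior $\widetilde W$ on $\theta\in\mathbb{R}^{k_n}$ induces the prior $W$ on $F=\Phi\theta$. The posterior is computed when $F\sim W$ and, conditionally on $F$, $Y\sim\mathcal{N}(F,\sigma_n^2I_n)$; $W(d(GF)\mid Y)$ is the posterior distribution of $GF$. Everything depends on $n$. Gaussian distributions with singular covariance are allowed; $\|\cdot\|$ is the Euclidean norm and $\|Q-Q'\|_{\mathrm{TV}}=\sup_A|Q(A)-Q'(A)|$. *)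

(* Defs.v *)
From HB Require Import structures.
From mathcomp Require Import all_boot all_order all_algebra.
From mathcomp Require Import all_classical all_reals all_analysis measurable_realfun.

Set Implicit Arguments.
Unset Strict Implicit.
Unset Printing Implicit Defensive.

Import Order.TTheory GRing.Theory Num.Theory.
Import numFieldNormedType.Exports.

Local Open Scope classical_set_scope.
Local Open Scope ring_scope.

(* Matrices carry the product sigma-algebra, i.e. the one generated by the
   entries; on real matrices it is the Borel sigma-algebra. *)
Definition mx_display : measure_display -> measure_display.
Proof. exact. Qed.

Definition entry_cylinders d (T : measurableType d) (m n : nat) :
    set (set 'M[T]_(m, n)) :=
  [set C | exists i j (A : set T), measurable A /\
             C = (fun M : 'M[T]_(m, n) => M i j) @^-1` A].

Section mx_measurable.
Context d (T : measurableType d) (m n : nat).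

Let mx_measurable : set (set 'M[T]_(m, n)) := <<s @entry_cylinders d T m n >>.

Let mx_set0 : mx_measurable set0.
Proof. exact: sigma_algebra0. Qed.

Let mx_setC A : mx_measurable A -> mx_measurable (~` A).
Proof. exact: sigma_algebraC. Qed.

Let mx_bigcup (F : (set 'M[T]_(m, n))^nat) : (forall i, mx_measurable (F i)) ->
  mx_measurable (\bigcup_i (F i)).
Proof. exact: sigma_algebra_bigcup. Qed.

HB.instance Definition _ := @isMeasurable.Build (mx_display d)
  'M[T]_(m, n) mx_measurable mx_set0 mx_setC mx_bigcup.

End mx_measurable.

Lemma measurable_entry d (T : measurableType d) m n (i : 'I_m) (j : 'I_n) :
  measurable_fun [set: 'M[T]_(m, n)] (fun M => M i j).
Proof.
move=> _ A mA; rewrite setTI; apply: sub_sigma_algebra.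
by exists i, j, A.
Qed.

Lemma measurable_fun_mx d1 (S : measurableType d1) d (T : measurableType d)
    m n (f : S -> 'M[T]_(m, n)) :
  (forall i j, measurable_fun [set: S] (fun x => f x i j)) ->
  measurable_fun [set: S] f.
Proof.
move=> mf; apply: (@measurability _ _ _ _ _ _ (@entry_cylinders d T m n)) => //.
by move=> _ [_ [i [j [A [mA ->]]]] <-]; exact: (mf i j measurableT A mA).
Qed.

Section affine.
Context {R : realType} {q p : nat}.

Definition affine (m : 'cV[R]_p) (A : 'M[R]_(p, q)) (z : 'cV[R]_q) : 'cV[R]_p :=
  m + A *m z.

Lemma measurable_affine m A : measurable_fun [set: 'cV[R]_q] (affine m A).
Proof.
apply: measurable_fun_mx => i j.
rewrite (_ : (fun x => _) =
    (fun x : 'cV[R]_q => m i j + \sum_(l < q) A i l * x l j)); last first.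
  by apply/funext => x; rewrite /affine !mxE.
apply: measurable_funD; first exact: measurable_cst.
apply: measurable_sum => l; apply: measurable_funM; first exact: measurable_cst.
exact: measurable_entry.
Qed.

HB.instance Definition _ m A :=
  isMeasurableFun.Build _ _ _ _ (affine m A) (measurable_affine m A).

End affine.

Section prepend.
Context {R : realType} {n : nat}.

Definition vcons (xv : measurableTypeR R * 'cV[R]_n) : 'cV[R]_n.+1 :=
  col_mx (const_mx xv.1 : 'cV[R]_1) xv.2.

Lemma measurable_vcons : measurable_fun [set: measurableTypeR R * 'cV[R]_n] vcons.
Proof.
apply: measurable_fun_mx => i j; rewrite /vcons.
case: (split_ordP (i : 'I_(1 + n))) => l ->.
  rewrite (_ : (fun x => _) = fst); first exact: measurable_fst.
  by apply/funext => x; apply: etrans (col_mxEu _ _ _ _) _; rewrite mxE.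
rewrite (_ : (fun x => _) = (fun v : 'cV[R]_n => v l j) \o snd).
  apply: measurableT_comp; first exact: measurable_entry.
  exact: measurable_snd.
by apply/funext => x; exact: col_mxEd.
Qed.

HB.instance Definition _ :=
  isMeasurableFun.Build _ _ _ _ vcons measurable_vcons.

Variables (mu : {sigma_finite_measure set (measurableTypeR R) -> \bar R})
          (nu : {sigma_finite_measure set 'cV[R]_n -> \bar R}).

Definition vcons_measure : set 'cV[R]_n.+1 -> \bar R :=
  pushforward (mu \x nu)%E vcons.

Let vcons_measure0 : vcons_measure set0 = 0%E.
Proof. exact: measure0. Qed.

Let vcons_measure_ge0 A : (0 <= vcons_measure A)%E.
Proof. exact: measure_ge0. Qed.

Let vcons_measure_sigma_additive : semi_sigma_additive vcons_measure.
Proof.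
have := @measure_semi_sigma_additive _ _ _ (pushforward (mu \x nu)%E vcons).
exact.
Qed.

HB.instance Definition _ := isMeasure.Build _ _ _ vcons_measure
  vcons_measure0 vcons_measure_ge0 vcons_measure_sigma_additive.

Let vcons_measure_sigma_finite : sigma_finite setT vcons_measure.
Proof.
have [F [TF ndF Foo]] := (sigma_finiteP _ _).1 (sigma_finiteT mu).
have [G [TG ndG Goo]] := (sigma_finiteP _ _).1 (sigma_finiteT nu).
pose uncons (v : 'cV[R]_n.+1) : measurableTypeR R * 'cV[R]_n :=
  (v ord0 ord0, dsubmx (v : 'cV[R]_(1 + n))).
have vconsK : cancel vcons uncons.
  case=> x v; rewrite /uncons /vcons col_mxKd; congr pair.
  rewrite (_ : ord0 = lshift n (ord0 : 'I_1)); last exact/val_inj.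
  by apply: etrans (col_mxEu _ _ _ _) _; rewrite mxE.
have muncons : measurable_fun setT uncons.
  apply/measurable_fun_pairP; split; first exact: measurable_entry.
  apply: measurable_fun_mx => i j.
  rewrite (_ : (fun x => _) = fun v : 'cV[R]_n.+1 => v (rshift 1 i) j).
    exact: measurable_entry.
  by apply/funext => v /=; rewrite mxE.
exists (fun k => uncons @^-1` (F k `*` G k)).
  apply/esym/seteqP; split => // v _.
  have : (\bigcup_k F k) (uncons v).1 by rewrite -TF.
  have : (\bigcup_k G k) (uncons v).2 by rewrite -TG.
  move=> [b _ Gb] [a _ Fa]; exists (maxn a b) => //; split => /=.
  - by move: Fa; exact/subsetPset/ndF/leq_maxl.
  - by move: Gb; exact/subsetPset/ndG/leq_maxr.
move=> k; have [mFk Fkoo] := Foo k; have [mGk Gkoo] := Goo k.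
have mFG : measurable (F k `*` G k) by exact: measurableX.
split; first by rewrite -[X in measurable X]setTI; exact: muncons.
rewrite /vcons_measure /pushforward.
rewrite (_ : _ @^-1` _ = F k `*` G k).
  by rewrite product_measure1E// lte_mul_pinfty// ge0_fin_numE.
by rewrite -comp_preimage (_ : _ \o _ = id)//; apply/funext => y; exact: vconsK.
Qed.

HB.instance Definition _ := Measure_isSigmaFinite.Build _ _ _ vcons_measure
  vcons_measure_sigma_finite.

End prepend.

Section power_measure.
Context {R : realType}.

(* n-fold product of mu, on column vectors; on 'cV_0 it is the unit mass *)
Fixpoint mpower (mu : {sigma_finite_measure set (measurableTypeR R) -> \bar R}) (n : nat) :
    {sigma_finite_measure set 'cV[R]_n -> \bar R} :=
  match n with
  | 0 => @dirac _ 'cV[R]_0 0 R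
  | n'.+1 => vcons_measure mu (mpower mu n')
  end.

Lemma mpowerT (P : probability (measurableTypeR R) R) n : mpower P n setT = 1%E.
Proof.
elim: n => [|n IHn] /=; first exact: diracT.
rewrite /vcons_measure /pushforward preimage_setT -setXTT product_measure1E//.
by rewrite [X in (_ * X)%E]IHn mule1; exact: probability_setT.
Qed.

Definition lebesgue (n : nat) : {sigma_finite_measure set 'cV[R]_n -> \bar R} :=
  mpower (@lebesgue_measure R) n.

Definition std_normal (n : nat) : set 'cV[R]_n -> \bar R :=
  mpower (normal_prob (0 : R) 1) n.

Arguments std_normal n A : clear implicits.

HB.instance Definition _ n := Measure.on (std_normal n).
HB.instance Definition _ n := Measure_isProbability.Build _ _ _ (std_normal n)
  (mpowerT _ n).

End power_measure.

Arguments std_normal {R} n A.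

Section gaussian.
Context {R : realType}.

Definition mxroot n (C : 'M[R]_n) : 'M[R]_n :=
  xget 0 [set A : 'M[R]_n | A *m A^T = C].

(* N(m, C): the law of m + A Z with Z standard normal and A A^T = C. Such an A
   exists iff C is symmetric positive semidefinite (C may be singular), and the
   law does not depend on the choice of A. *)
Definition gaussian n (m : 'cV[R]_n) (C : 'M[R]_n) : set 'cV[R]_n -> \bar R :=
  distribution (std_normal n) (affine m (mxroot C)).

HB.instance Definition _ n (m : 'cV[R]_n) (C : 'M[R]_n) :=
  Probability.on (gaussian m C).

End gaussian.

Definition tv_dist {R : realType} d (T : measurableType d)
    (P Q : set T -> \bar R) : \bar R :=
  ereal_sup [set `|P A - Q A|%E | A in measurable].

(* The library norm on matrices is the max norm. *)
Definition enorm {R : realType} n (v : 'cV[R]_n) : R :=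
  Num.sqrt (\sum_i v i 0 ^+ 2).

Section regression.
Context {R : realType} {n k : nat}.

Definition hat (Phi : 'M[R]_(n, k)) : 'M[R]_n :=
  Phi *m invmx (Phi^T *m Phi) *m Phi^T.

Definition lse (Phi : 'M[R]_(n, k)) (F : 'cV[R]_n) : 'cV[R]_k :=
  invmx (Phi^T *m Phi) *m Phi^T *m F.

(* K is a version of the conditional distribution of G F given Y in the model
   F ~ W, Y | F ~ N(F, s^2 I): E[1_A(Y) 1_B(G F)] = E[1_A(Y) K(Y, B)]. *)
Definition is_posterior p (W : probability 'cV[R]_n R) (s : R)
    (G : 'M[R]_(p, n)) (K : R.-pker 'cV[R]_n ~> 'cV[R]_p) : Prop :=
  forall (A : set 'cV[R]_n) (B : set 'cV[R]_p), measurable A -> measurable B ->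
    (\int[W]_(f in mulmx G @^-1` B) gaussian f (s ^+ 2)%:M A =
     \int[W]_f \int[gaussian f (s ^+ 2)%:M]_(y in A) K y B)%E.

Definition has_density (P : probability 'cV[R]_k R) (w : 'cV[R]_k -> R) : Prop :=
  [/\ measurable_fun setT w, forall t, 0 <= w t &
    forall A, measurable A -> P A = (\int[lebesgue k]_(t in A) (w t)%:E)%E].

(* Ratios are taken in \bar R, where c / 0 = +oo for c > 0 and 0 / 0 = 0: a
   supremum close to 1 forces w to be positive on the whole ellipsoid. *)
Definition sup_ratio (Phi : 'M[R]_(n, k)) (w : 'cV[R]_k -> R)
    (t0 : 'cV[R]_k) (r2 : R) : \bar R :=
  ereal_sup [set z : \bar R | exists h g : 'cV[R]_k,
    [/\ enorm (Phi *m h) ^+ 2 <= r2, enorm (Phi *m g) ^+ 2 <= r2 &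
        z = ((w (t0 + h))%:E / (w (t0 + g))%:E)%E]].

End regression.

(* Main.v *)
From HB Require Import structures.
Require Import Defs.
From mathcomp Require Import all_boot all_order all_algebra.
From mathcomp Require Import all_classical all_reals all_analysis measurable_realfun.
From mathcomp Require Import ring lra.

Set Implicit Arguments.
Unset Strict Implicit.
Unset Printing Implicit Defensive.

Import Order.TTheory GRing.Theory Num.Theory.
Import numFieldNormedType.Exports.

Local Open Scope classical_set_scope.
Local Open Scope ring_scope.

(** Choose L with L L^T = Phi^T Phi and put D = Phi L^-T, so that D^T D = 1 and
    D D^T = hat Phi.  In the coordinate z given by F = s D z, the likelihood of Y
    is, up to a factor depending on Y only, the standard normal density phi
    centred at x = s^-1 D^T Y.  If v is the prior density of z and c > 0 is any
    constant, the posterior, proportional to v phi(. - x), is within total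
    variation distance 2 \int |v / c - 1| phi(. - x) of N(x, I).  Since
    x ~ N(x0, I) with x0 = s^-1 D^T F0, the expectation over Y of this bound is
    2 E |v(x0 + sqrt 2 Z) / c - 1| with Z standard normal in R^k.

    Under (A), v is proportional to exp(- b |z|^2 / 2) with b = (s / tau)^2; for
    c the mean of v(x0 + sqrt 2 Z), the relative variance is at most
    exp(2 k b^2 + 2 b^2 |x0|^2) - 1.  Under (B), take c = v(x0): the integrand is
    small on the ball |z - x0|^2 <= M, and outside it the density of N(x0, 2 I)
    is at most exp(- M / 4), which beats 1 / c. *)

(** The covariance of the limit may be singular, so densities are compared in z, in R^k, and both
    laws of G F are images of measures there. Misspecification costs nothing: the residual of Y off
    the range of Phi enters only the factor that depends on Y alone, and F0 survives only through
    x0. The posterior is an arbitrary kernel, fixed for each event only up to a null set of Y, while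
    total variation is a supremum over uncountably many events; a countable pi-system provides one
    null set for all of them. The constant c is free because the normalisation of the posterior is
    never computed: comparing unnormalised densities costs one oscillation, the unknown total mass a
    second one, whence the factor 2.

    Under (A) the terms of first order in b cancel between the second moment and the squared mean.
    What remains has order k b^2 + b^2 |x0|^2, where b^2 = (s / tau)^4 and b^2 |x0|^2 <= (s |F0| /
    tau^2)^2: these are the quantities that (A) makes small. Under (B), 1 / c is the argument of the
    logarithm in (3). Condition (2) pays for the tail of N(x0, 2 I), of size sqrt 2 ^ k exp(- M /
    8), and makes M tend to infinity since k >= 2. *)

Local Notation image_measure :=
  measure_function_pushforward__canonical__measure_function_Measure.

(** * Integration against densities and product measures *)

Section change_of_density.
Context d (T : measurableType d) (R : realType).
Variables (mu nu : {measure set T -> \bar R}) (f : T -> R).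
Hypotheses (mf : measurable_fun setT f) (f0 : forall x, 0 <= f x).
Hypothesis nuE : forall A, measurable A -> nu A = (\int[mu]_(x in A) (f x)%:E)%E.
Local Open Scope ereal_scope.

Import HBNNSimple.

(** Both sides are monotone limits along the simple functions [h n] below [g]; for these the claim
    reduces to [nuE] on each level set. *)
Lemma ge0_integral_density (g : T -> \bar R) :
  measurable_fun setT g -> (forall x, 0 <= g x) ->
  \int[nu]_x g x = \int[mu]_x (g x * (f x)%:E).
Proof.
move=> mg g0; pose h := nnsfun_approx measurableT mg.
have hg x : (h n x)%:E @[n --> \oo] --> g x by exact: cvg_nnsfun_approx.
have mEf : measurable_fun setT (EFin \o f) by exact/measurable_EFinP.
have -> : \int[nu]_x g x = lim (\int[nu]_x (h n x)%:E @[n --> \oo]).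
  rewrite -monotone_convergence//.
  - by apply: eq_integral => x _; apply/esym/cvg_lim => //; exact: hg.
  - by move=> n; exact/measurable_EFinP.
  - by move=> n x _; rewrite lee_fin.
  - by move=> x _ a b ab; rewrite lee_fin; exact/lefP/nd_nnsfun_approx.
have -> : \int[mu]_x (g x * (f x)%:E) =
    lim (\int[mu]_x ((h n x)%:E * (f x)%:E) @[n --> \oo]).
  rewrite -monotone_convergence//.
  - apply: eq_integral => x _; apply/esym/cvg_lim => //.
    by apply: cvgeZr => //; exact: hg.
  - by move=> n; apply: emeasurable_funM => //; exact/measurable_EFinP.
  - by move=> n x _; rewrite mule_ge0 ?lee_fin.
  - move=> x _ a b ab; rewrite lee_wpmul2r ?lee_fin//.
    exact/lefP/nd_nnsfun_approx.
congr (lim (_ @ \oo)); apply/funext => n.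
rewrite integralT_nnsfun sintegralE.
have -> : \int[mu]_x ((h n x)%:E * (f x)%:E) =
   \int[mu]_x (\sum_(y \in range (h n))
      (y * \1_(h n @^-1` [set y]) x)%:E * (f x)%:E).
  apply: eq_integral => x _; rewrite -ge0_mule_fsuml; last first.
    by move=> y; exact: nnfun_muleindic_ge0.
  by rewrite fsumEFin// -(fimfunE (h n)).
rewrite ge0_integral_fsum//; last 2 first.
  - move=> y; apply: emeasurable_funM => //.
    apply/measurable_EFinP/measurable_funM => //; exact: measurable_indic.
  - by move=> y x _; rewrite mule_ge0 ?lee_fin// -lee_fin EFinM nnfun_muleindic_ge0.
apply: eq_fsbigr => r _.
have mhr : measurable (h n @^-1` [set r]) by [].
(* Pulling [r] out of the integral requires [0 <= r]; the level set of a negative [r] is empty. *)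
have [rn|rn] := boolP (0 <= r)%R; last first.
  have hr0 : h n @^-1` [set r] = set0 by apply: preimage_nnfun0; rewrite ltNge.
  rewrite hr0 measure0 mule0 integral0_eq// => x _.
  by rewrite indic0 mulr0 mul0e.
rewrite nuE//.
under [RHS]eq_integral do rewrite EFinM -muleA.
rewrite ge0_integralZl//; last 2 first.
  - by apply: emeasurable_funM => //; apply/measurable_EFinP; exact: measurable_indic.
  - by move=> x _; rewrite mule_ge0 ?lee_fin// indicE.
congr (_ * _); rewrite integral_mkcond.
apply: eq_integral => x _; rewrite muleC.
by rewrite epatch_indic.
Qed.

End change_of_density.

Lemma integral_EFinZl d (T : measurableType d) (R : realType)
    (mu : {measure set T -> \bar R}) (a c : R) (f : T -> R) :
  0 <= a -> measurable_fun setT f -> (forall x, 0 <= f x) ->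
  (\int[mu]_x (f x)%:E = c%:E)%E -> (\int[mu]_x (a * f x)%:E = (a * c)%:E)%E.
Proof.
move=> a0 mf f0 fE; under eq_integral do rewrite EFinM.
rewrite ge0_integralZl ?fE//; first exact/measurable_EFinP.
by move=> x _; rewrite lee_fin.
Qed.

Section mpower_integral.
Context {R : realType}.
Variable mu : {sigma_finite_measure set (measurableTypeR R) -> \bar R}.
Local Open Scope ereal_scope.

Lemma integral_mpowerS n (f : 'cV[R]_n.+1 -> \bar R) :
  measurable_fun setT f -> (forall x, 0 <= f x) ->
  \int[mpower mu n.+1]_x f x = \int[mu]_x \int[mpower mu n]_v f (vcons (x, v)).
Proof.
move=> mf f0 /=; rewrite ge0_integral_pushforward//=.
rewrite fubini_tonelli1//; apply: measurableT_comp => //.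
Qed.

(** This order serves maps that shift the first coordinate by an amount depending on the others. *)
Lemma integral_mpowerS_rev n (f : 'cV[R]_n.+1 -> \bar R) :
  measurable_fun setT f -> (forall x, 0 <= f x) ->
  \int[mpower mu n.+1]_x f x = \int[mpower mu n]_v \int[mu]_x f (vcons (x, v)).
Proof.
move=> mf f0; rewrite integral_mpowerS//.
apply: (@fubini_tonelli _ _ _ _ _ mu (mpower mu n) (f \o vcons)).
  exact: measurableT_comp.
by move=> z; exact: f0.
Qed.

End mpower_integral.

(** * Lebesgue measure under linear maps *)

Section linear_change_of_variables.
Context {R : realType}.
Local Notation leb := (@lebesgue_measure R).

Let measurable_affine1 (a b : R) : measurable_fun setT
  (fun x : measurableTypeR R => a * x + b : measurableTypeR R).
Proof.
apply: measurable_funD; last exact: measurable_cst.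
by apply: measurable_funM => //; exact: measurable_cst.
Qed.

(** By uniqueness of Lebesgue measure it is enough to compute lengths of half-open intervals. *)
Lemma lebesgue_measure_affine (a b : R) (A : set (measurableTypeR R)) :
  a != 0 -> measurable A ->
  (leb A = `|a|%:E * leb ((fun x => a * x + b)%R @^-1` A))%E.
Proof.
move=> a0 mA.
have mg := measurable_affine1 a b.
pose m := mscale (NngNum (normr_ge0 a)) (image_measure leb mg).
rewrite -[RHS]/(m A); apply: lebesgue_measure_unique => //.
move=> _ [[u v] /= uv <-]; rewrite /m /mscale /= /pushforward.
have aa : `|a| * `|a|^-1 = 1 by rewrite divff// normr_eq0.
have [a_gt0|a_lt0] : 0 < a \/ a < 0 by move: a0; rewrite neq_lt => /orP[]; auto.
- have -> : (fun x => a * x + b) @^-1` `]u, v]%classic =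
      `]((u - b) / a), ((v - b) / a)]%classic.
    apply/seteqP; split => x /=; rewrite !in_itv/= ltr_pdivrMr// ler_pdivlMr//;
      by rewrite ltrBlDr lerBrDr mulrC.
  rewrite !lebesgue_measure_itv/= !lte_fin ltr_pM2r ?invr_gt0// ltrD2r.
  case: ifPn => _; last by rewrite mule0.
  by rewrite -!EFinD -EFinM gtr0_norm//; congr EFin; field; rewrite gt_eqF.
(* A negative slope exchanges the open and the closed end, which leaves the length unchanged. *)
- have -> : (fun x => a * x + b) @^-1` `]u, v]%classic =
      `[((v - b) / a), ((u - b) / a)[%classic.
    apply/seteqP; split => x /=; rewrite !in_itv/= ltr_ndivlMr// ler_ndivrMr//;
      by rewrite ltrBlDr lerBrDr mulrC andbC.
  rewrite !lebesgue_measure_itv/= !lte_fin ltr_nM2r ?invr_lt0// ltrD2r.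
  case: ifPn => _; last by rewrite mule0.
  by rewrite -!EFinD -EFinM ltr0_norm//; congr EFin; field; rewrite lt_eqF.
Qed.

Lemma integral_lebesgue_affine (a b : R) (f : measurableTypeR R -> \bar R) :
  a != 0 -> measurable_fun setT f -> (forall x, 0 <= f x)%E ->
  (\int[leb]_x f x = `|a|%:E * \int[leb]_x f (a * x + b)%R)%E.
Proof.
move=> a0 mf f0.
have mg := measurable_affine1 a b.
pose m := mscale (NngNum (normr_ge0 a)) (image_measure leb mg).
transitivity (\int[m]_x f x)%E.
  apply: eq_measure_integral => A mA _.
  exact: (lebesgue_measure_affine b a0 mA).
rewrite ge0_integral_mscale//.
by rewrite ge0_integral_pushforward//= preimage_setT.
Qed.

Lemma measurable_mulmx m n (A : 'M[R]_(m, n)) :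
  measurable_fun [set: 'cV[R]_n] (mulmx A).
Proof.
have := measurable_affine 0 A; congr (measurable_fun _ _).
by apply/funext => x; rewrite /affine add0r.
Qed.

Lemma measurable_addmx n (b : 'cV[R]_n) :
  measurable_fun [set: 'cV[R]_n] (fun x => x + b).
Proof.
have := measurable_affine b 1%:M; congr (measurable_fun _ _).
by apply/funext => x; rewrite /affine mul1mx addrC.
Qed.

Lemma measurable_subr2 k :
  measurable_fun setT (fun xz : 'cV[R]_k * 'cV[R]_k => xz.2 - xz.1).
Proof.
apply: measurable_fun_mx => i j.
rewrite (_ : (fun x => _) = fun x : 'cV[R]_k * 'cV[R]_k =>
   x.2 i j - x.1 i j); last by apply/funext => x; rewrite !mxE.
apply: measurable_funB.
  exact: (measurableT_comp (measurable_entry i j) (@measurable_snd _ _ _ _)).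
exact: (measurableT_comp (measurable_entry i j) (@measurable_fst _ _ _ _)).
Qed.

Lemma measurable_vconsr n (x : R) :
  measurable_fun [set: 'cV[R]_n] (fun v => vcons (x, v)).
Proof.
apply: (measurableT_comp (@measurable_vcons R n)).
apply/measurable_fun_pairP; split; last exact: measurable_id.
exact: (@measurable_cst _ _ _ (measurableTypeR R) _ x).
Qed.

Lemma measurable_vconsl n (v : 'cV[R]_n) :
  measurable_fun [set: measurableTypeR R] (fun x => vcons (x, v)).
Proof.
apply: (measurableT_comp (@measurable_vcons R n)).
apply/measurable_fun_pairP; split; first exact: measurable_id.
exact: (@measurable_cst _ _ _ _ _ v).
Qed.

Lemma vconsE n (x : R) (v : 'cV[R]_n) : vcons (x, v) = col_mx (const_mx x : 'cV_1) v :> 'cV_(1 + n).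
Proof. by []. Qed.

Lemma vconsD n (x y : R) (u v : 'cV[R]_n) :
  vcons (x, u) + vcons (y, v) = vcons (x + y, u + v).
Proof.
apply: etrans (@add_col_mx _ 1 n 1 _ _ _ _) _; rewrite vconsE; congr col_mx.
by apply/matrixP => i j; rewrite !mxE.
Qed.

Lemma vcons_eta n (b : 'cV[R]_n.+1) : exists x v, b = vcons (x, v).
Proof.
exists (b 0 0), (dsubmx (b : 'cV[R]_(1 + n))).
apply: etrans (esym (@vsubmxK _ 1 n 1 b)) _; rewrite vconsE; congr col_mx.
by apply/matrixP => i j; rewrite !ord1 !mxE; congr (b _ _); exact/val_inj.
Qed.

Lemma block_mx_vcons n (a : R) (b : 'rV[R]_n) (c : 'cV[R]_n) (D : 'M[R]_n) x v :
  (block_mx (a%:M : 'M[R]_1) b c D : 'M[R]_(n.+1)) *m vcons (x, v) =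
  vcons (a * x + (b *m v) 0 0, x *: c + D *m v).
Proof.
apply: etrans (@mul_block_col _ 1 n 1 n 1 _ _ _ _ _ _) _.
rewrite vconsE; congr col_mx.
  by apply/matrixP => i j; rewrite !ord1 mul_scalar_mx !mxE.
congr (_ + _).
by apply/matrixP => i j; rewrite !ord1 !mxE big_ord1 !mxE mulrC.
Qed.

Lemma integral_lebesgue_translate n (b : 'cV[R]_n) (f : 'cV[R]_n -> \bar R) :
  measurable_fun setT f -> (forall x, 0 <= f x)%E ->
  (\int[lebesgue n]_x f x = \int[lebesgue n]_x f (x + b)%R)%E.
Proof.
elim: n b f => [|n IHn] b f mf f0.
  by apply: eq_integral => x _; congr f; apply/matrixP => -[].
have [y [w ->]] := vcons_eta b.
rewrite /lebesgue integral_mpowerS// integral_mpowerS//; last first.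
  by apply: measurableT_comp => //; exact: measurable_addmx.
rewrite (integral_lebesgue_affine y (oner_neq0 R)); last 2 first.
- exact: (@measurable_fun_fubini_tonelli_F _ _ _ _ _ (mpower leb n) (f \o vcons)
    (measurableT_comp mf (measurable_vcons)) (fun z => f0 _)).
- by move=> x; apply: integral_ge0 => v _; exact: f0.
rewrite normr1 mul1e; apply: eq_integral => x _; rewrite mul1r.
rewrite (IHn w (fun v => f (vcons (x + y, v))))//.
  by apply: eq_integral => v _; rewrite vconsD.
exact: (measurableT_comp mf (measurable_vconsr _)).
Qed.

(** Preservation is meant up to the Jacobian factor. As a predicate on matrices it is stable under
    products, so it need only be checked on elementary block factors. *)
Definition preserves_lebesgue n (A : 'M[R]_n) := forall f : 'cV[R]_n -> \bar R,
  measurable_fun setT f -> (forall x, 0 <= f x)%E ->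
  (\int[lebesgue n]_x f x = `|\det A|%:E * \int[lebesgue n]_x f (A *m x)%R)%E.

Lemma preserves_lebesgueM n (A B : 'M[R]_n) :
  preserves_lebesgue A -> preserves_lebesgue B -> preserves_lebesgue (A *m B).
Proof.
move=> pA pB f mf f0; rewrite pA// (pB (fun x => f (A *m x)))//; last first.
  by apply: measurableT_comp => //; exact: measurable_mulmx.
rewrite det_mulmx normrM EFinM muleA; congr (_ * _)%E.
by apply: eq_integral => x _; rewrite mulmxA.
Qed.

(** With the first coordinate [x] fixed, the shear translates the remaining ones by [x *: c]. *)
Lemma preserves_lebesgue_lshear n (c : 'cV[R]_n) :
  preserves_lebesgue (block_mx (1%:M : 'M[R]_1) 0 c 1%:M : 'M[R]_(n.+1)).
Proof.
move=> f mf f0; rewrite (@det_lblock _ 1 n) !det1 mul1r normr1 mul1e.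
rewrite /lebesgue !integral_mpowerS//; last first.
  by apply: measurableT_comp => //; exact: measurable_mulmx.
apply: eq_integral => x _.
rewrite (@integral_lebesgue_translate n (x *: c) (fun v => f (vcons (x, v))))//.
  by apply: eq_integral => v _;
    rewrite block_mx_vcons mul1r mul0mx mxE addr0 mul1mx addrC.
exact: (measurableT_comp mf (measurable_vconsr _)).
Qed.

(** With the last coordinates fixed, the shear translates the first one, which is therefore
    integrated innermost. *)
Lemma preserves_lebesgue_ushear n (b : 'rV[R]_n) :
  preserves_lebesgue (block_mx (1%:M : 'M[R]_1) b 0 1%:M : 'M[R]_(n.+1)).
Proof.
move=> f mf f0; rewrite (@det_ublock _ 1 n) !det1 mul1r normr1 mul1e.
rewrite /lebesgue !integral_mpowerS_rev//; last first.
  by apply: measurableT_comp => //; exact: measurable_mulmx.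
apply: eq_integral => v _.
rewrite (@integral_lebesgue_affine 1 ((b *m v) 0 0) (fun x => f (vcons (x, v))))//.
- rewrite normr1 mul1e; apply: eq_integral => x _.
  by rewrite block_mx_vcons scaler0 add0r mul1mx.
- exact: (measurableT_comp mf (measurable_vconsl _)).
Qed.

Lemma preserves_lebesgue_diag n (a : R) (D : 'M[R]_n) : a != 0 ->
  preserves_lebesgue D ->
  preserves_lebesgue (block_mx (a%:M : 'M[R]_1) 0 0 D : 'M[R]_(n.+1)).
Proof.
move=> a0 pD f mf f0.
rewrite (@det_ublock _ 1 n) det_scalar1 normrM EFinM -muleA.
have mfA : measurable_fun setT
    (fun x => f ((block_mx (a%:M : 'M[R]_1) 0 0 D : 'M[R]_(n.+1)) *m x)).
  by apply: measurableT_comp => //; exact: measurable_mulmx.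
rewrite /lebesgue !integral_mpowerS//.
rewrite (@integral_lebesgue_affine a 0 (fun x =>
   \int[mpower leb n]_v f (vcons (x, v)))%E)//; last 2 first.
- exact: (@measurable_fun_fubini_tonelli_F _ _ _ _ _ (mpower leb n) (f \o vcons)
    (measurableT_comp mf (@measurable_vcons R n)) (fun z => f0 _)).
- by move=> x; apply: integral_ge0 => v _; exact: f0.
congr (_ * _)%E; rewrite -ge0_integralZl//; last 2 first.
- exact: (@measurable_fun_fubini_tonelli_F _ _ _ _ _ (mpower leb n) 
    ((fun x => f ((block_mx (a%:M : 'M[R]_1) 0 0 D : 'M[R]_(n.+1)) *m x)) \o vcons)
    (measurableT_comp mfA (@measurable_vcons R n)) (fun z => f0 _)).
- by move=> x; move=> _; apply: integral_ge0 => v _; exact: f0.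
apply: eq_integral => x _; rewrite (pD (fun v => f (vcons (a * x + 0, v))))//.
  congr (_ * _)%E; apply: eq_integral => v _.
  by rewrite block_mx_vcons mul0mx mxE scaler0 add0r.
exact: (measurableT_comp mf (measurable_vconsr _)).
Qed.

(* Block elimination of the first row and column; when the pivot vanishes, an
   upper shear first adds to the first row one with a nonzero pivot. *)
Lemma integral_lebesgue_linear n (A : 'M[R]_n) :
  A \in unitmx -> preserves_lebesgue A.
Proof.
elim: n A => [|n IHn] A uA.
  move=> f mf f0; rewrite det_mx00 normr1 mul1e; apply: eq_integral => x _.
  by congr f; apply/matrixP => -[].
wlog a0 : A uA / A 0 0 != 0.
  have [|a0] := eqVneq (A 0 0) 0; last by move=> /(_ A uA a0).
  move=> a0 Hw.
  (* Otherwise the whole first column vanishes and so does the determinant. *)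
  have [i ci] : exists i : 'I_n, A (lift 0 i) 0 != 0.
    apply/existsP; apply: contraLR uA; rewrite negb_exists => /forallP c0.
    rewrite unitmxE (expand_det_col _ 0) big1 ?unitr0// => i _.
    case: (unliftP 0 i) => [j|] -> ; last by rewrite a0 mul0r.
    by have := c0 j; rewrite negbK => /eqP ->; rewrite mul0r.
  pose U e := block_mx (1%:M : 'M[R]_1) (e *: delta_mx 0 i) 0 1%:M : 'M[R]_(n.+1).
  have UU : U (-1) *m U 1 = 1%:M.
    rewrite /U; apply: etrans (@mulmx_block _ 1 n 1 n 1 n _ _ _ _ _ _ _ _) _.
    by rewrite !mul1mx !mulmx0 !mulmx1 !addr0 !mul0mx !add0r scaleN1r scale1r
       subrr -scalar_mx_block.
  have -> : A = U (-1) *m (U 1 *m A) by rewrite mulmxA UU mul1mx.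
  apply: preserves_lebesgueM; first exact: preserves_lebesgue_ushear.
  apply: Hw.
    rewrite unitmx_mul uA andbT unitmxE /U (@det_ublock _ 1 n) !det1 mul1r.
    exact: unitr1.
  suff -> : (U 1 *m A) 0 0 = A (lift 0 i) 0 by [].
  have Ue j : U 1 0 (lift 0 j) = (j == i)%:R.
    rewrite -rshift1 -(lshift0 n 0) /U.
    apply: etrans (@block_mxEur _ 1 n 1 n _ _ _ _ 0 j) _.
    by rewrite !mxE eqxx mul1r.
  rewrite mxE big_ord_recl a0 mulr0 add0r (bigD1 i)//= big1 ?addr0 => [|j ji].
    by rewrite Ue eqxx mul1r.
  by rewrite Ue (negbTE ji) mul0r.
pose b := ursubmx (A : 'M[R]_(1 + n)); pose c := dlsubmx (A : 'M[R]_(1 + n)).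
(* The Schur complement of the pivot; it is invertible because [A] and both shears are, so the
   induction hypothesis applies to it. *)
pose D := drsubmx (A : 'M[R]_(1 + n)) - (A 0 0)^-1 *: (c *m b).
pose L := block_mx (1%:M : 'M[R]_1) 0 ((A 0 0)^-1 *: c) 1%:M : 'M[R]_(n.+1).
pose V := block_mx (1%:M : 'M[R]_1) ((A 0 0)^-1 *: b) 0 1%:M : 'M[R]_(n.+1).
pose A0 := block_mx ((A 0 0)%:M : 'M[R]_1) 0 0 D : 'M[R]_(n.+1).
have AE : A = L *m (A0 *m V).
  rewrite /A0 /V.
  rewrite (@mulmx_block _ 1 n 1 n 1 n _ _ _ _ _ _ _ _) /L.
  apply/esym; apply: etrans (@mulmx_block _ 1 n 1 n 1 n _ _ _ _ _ _ _ _) _.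
  rewrite !mul1mx !mulmx0 !mulmx1 !mul0mx !addr0 !add0r mul_scalar_mx scalerA.
  rewrite divff// scale1r -!scalemxAl mul_mx_scalar scalerA mulVf// scale1r.
  rewrite addrC subrK; apply: etrans (@submxK _ 1 n 1 n A); congr block_mx.
  by apply/matrixP => i j; rewrite !ord1 !mxE/= mulr1n; congr (A _ _); exact/val_inj.
have uD : D \in unitmx.
  move: uA; rewrite AE !unitmx_mul => /and3P[_ + _].
  by rewrite !unitmxE /A0 (@det_ublock _ 1 n) unitrM => /andP[].
rewrite AE; apply: preserves_lebesgueM; first exact: preserves_lebesgue_lshear.
apply: preserves_lebesgueM; last exact: preserves_lebesgue_ushear.
by apply: preserves_lebesgue_diag => //; exact: IHn.
Qed.

End linear_change_of_variables.

(** * Gaussian laws *)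

Section gaussian_integrals.
Context {R : realType}.
Local Notation leb := (@lebesgue_measure R).

Definition sqn n (x : 'cV[R]_n) : R := \sum_i x i 0 ^+ 2.

Lemma sqn_ge0 n (x : 'cV[R]_n) : 0 <= sqn x.
Proof. by apply: sumr_ge0 => i _; exact: sqr_ge0. Qed.

Lemma sqnE n (x : 'cV[R]_n) : sqn x = (x^T *m x) 0 0.
Proof. by rewrite mxE; apply: eq_bigr => i _; rewrite mxE expr2. Qed.

Lemma enorm_sqr n (x : 'cV[R]_n) : enorm x ^+ 2 = sqn x.
Proof. by rewrite sqr_sqrtr// sqn_ge0. Qed.

Lemma sqn_vcons n (x : R) (v : 'cV[R]_n) : sqn (vcons (x, v)) = x ^+ 2 + sqn v.
Proof.
rewrite /sqn (@big_split_ord _ _ _ 1 n)/= big_ord1; congr (_ ^+ 2 + _).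
  by apply: etrans (@col_mxEu _ 1 n 1 _ _ 0 0) _; rewrite mxE.
by apply: eq_bigr => i _; congr (_ ^+ 2); apply: etrans (@col_mxEd _ 1 n 1 _ _ i 0) _.
Qed.

Lemma sqnZ n a (x : 'cV[R]_n) : sqn (a *: x) = a ^+ 2 * sqn x.
Proof. by rewrite /sqn mulr_sumr; apply: eq_bigr => i _; rewrite mxE exprMn. Qed.

Lemma measurable_sqn n : measurable_fun setT (@sqn n).
Proof.
by apply: measurable_sum => i; apply: measurable_funX; exact: measurable_entry.
Qed.

(* Density of N(0, t I). *)
Definition gpdf n (t : R) (x : 'cV[R]_n) : R :=
  (Num.sqrt (t * (pi *+ 2)))^-1 ^+ n * expR (- (sqn x / (t *+ 2))).

Lemma measurable_expR_sqn n (a : R) (m : 'cV[R]_n) :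
  measurable_fun setT (fun x : 'cV[R]_n => expR (a * sqn (x + m))).
Proof.
apply: measurableT_comp => //; apply: measurable_funM => //.
by apply: measurableT_comp; [exact: measurable_sqn|exact: measurable_addmx].
Qed.

Lemma measurable_gpdf n t : measurable_fun setT (@gpdf n t).
Proof.
apply: measurable_funM => //; apply: measurableT_comp => //.
apply: measurableT_comp => //; apply: measurable_funM => //; exact: measurable_sqn.
Qed.

Lemma gpdf_ge0 n t x : 0 <= @gpdf n t x.
Proof. by rewrite mulr_ge0 ?expR_ge0// exprn_ge0// invr_ge0 sqrtr_ge0. Qed.

Lemma gpdf_vcons n t (x : R) (v : 'cV[R]_n) :
  gpdf t (vcons (x, v)) = (Num.sqrt (t * (pi *+ 2)))^-1 * expR (- (x ^+ 2 / (t *+ 2))) * gpdf t v.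
Proof.
by rewrite /gpdf sqn_vcons mulrDl opprD expRD exprS mulrACA.
Qed.

Lemma integral_expR_sqr (a : R) : 0 < a ->
  (\int[leb]_x (expR (- (a * x ^+ 2)))%:E = (Num.sqrt (pi / a))%:E)%E.
Proof.
move=> a0; have sa0 : Num.sqrt a != 0 by rewrite gt_eqF// sqrtr_gt0.
have := @integralT_gauss R.
rewrite (integral_lebesgue_affine 0 sa0); last 2 first.
- by apply/measurable_EFinP; exact: measurable_gauss_fun.
- by move=> x; rewrite lee_fin gauss_fun_ge0.
have -> : (\int[leb]_x (gauss_fun (Num.sqrt a * x + 0))%:E =
    \int[leb]_x (expR (- (a * x ^+ 2)))%:E)%E.
  apply: eq_integral => x _; rewrite /gauss_fun addr0 exprMn sqr_sqrtr// ltW//.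
move=> /(congr1 (fun z => ((`|Num.sqrt a|^-1)%:E * z)%E)).
rewrite muleA -EFinM mulVf ?normr_eq0// mul1e => ->.
rewrite -EFinM ger0_norm ?sqrtr_ge0// sqrtrM ?pi_ge0// sqrtrV ?ltW// mulrC//.
Qed.

Lemma integral_expR_sqn n (a : R) : 0 < a ->
  (\int[lebesgue n]_x (expR (- (a * sqn x)))%:E = (Num.sqrt (pi / a) ^+ n)%:E)%E.
Proof.
move=> a0.
have mexp k : measurable_fun setT (fun x : 'cV[R]_k => (expR (- (a * sqn x)))%:E).
  apply/measurable_EFinP; have := @measurable_expR_sqn k (- a) 0.
  by apply: eq_measurable_fun => x _; rewrite addr0 mulNr.
elim: n => [|n IHn].
  rewrite /= integral_dirac//; last exact: mexp.
  by rewrite diracT mul1e /sqn big_ord0 mulr0 oppr0 expR0 expr0.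
rewrite /lebesgue integral_mpowerS//.
transitivity (\int[leb]_x ((expR (- (a * x ^+ 2)))%:E * (Num.sqrt (pi / a) ^+ n)%:E))%E.
  apply: eq_integral => x _; rewrite -IHn -ge0_integralZl//; last first.
    exact: mexp.
  by apply: eq_integral => v _; rewrite -EFinM sqn_vcons mulrDr opprD expRD.
rewrite ge0_integralZr//.
- by rewrite integral_expR_sqr// -EFinM exprS.
- apply/measurable_EFinP; apply: measurableT_comp => //.
  by apply: measurableT_comp => //; apply: measurable_funM.
Qed.

Lemma integral_gpdf n (t : R) (m : 'cV[R]_n) : 0 < t ->
  (\int[lebesgue n]_x (gpdf t (x - m))%:E = 1)%E.
Proof.
move=> t0; rewrite (integral_lebesgue_translate m); last 2 first.
- apply/measurable_EFinP; apply: measurableT_comp; first exact: measurable_gpdf.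
  exact: measurable_addmx.
- by move=> x; rewrite lee_fin gpdf_ge0.
have t20 : 0 < (t *+ 2)^-1 by rewrite invr_gt0 mulrn_wgt0.
transitivity (\int[lebesgue n]_x (((Num.sqrt (t * (pi *+ 2)))^-1 ^+ n)%:E *
   (expR (- ((t *+ 2)^-1 * sqn x)))%:E))%E.
  by apply: eq_integral => x _; rewrite addrK /gpdf -EFinM mulrC [(_ * sqn x)]mulrC mulrC.
rewrite ge0_integralZl//; last first.
- apply/measurable_EFinP; have := @measurable_expR_sqn n (- (t *+ 2)^-1) 0.
  by apply: eq_measurable_fun => x _; rewrite addr0 mulNr.
rewrite integral_expR_sqn// -EFinM -exprMn invrK.
have -> : pi * (t *+ 2) = t * (pi *+ 2) by ring.
by rewrite mulVf ?expr1n// gt_eqF// sqrtr_gt0 mulr_gt0// mulrn_wgt0// pi_gt0.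
Qed.

(** The law is built as a product of one-dimensional normal laws; peeling off one coordinate at a
    time assembles their densities into [gpdf 1]. *)
Lemma integral_std_normal n (f : 'cV[R]_n -> \bar R) :
  measurable_fun setT f -> (forall x, 0 <= f x)%E ->
  (\int[std_normal n]_x f x = \int[lebesgue n]_x (f x * (gpdf 1 x)%:E))%E.
Proof.
elim: n f => [|n IHn] f mf f0.
  rewrite /std_normal /= !integral_dirac//.
    by rewrite /gpdf expr0 mul1r /sqn big_ord0 mul0r oppr0 expR0 mule1.
  apply: emeasurable_funM => //; apply/measurable_EFinP; exact: measurable_gpdf.
have mp k : measurable_fun setT (fun x : 'cV[R]_k => (gpdf 1 x)%:E).
  by apply/measurable_EFinP; exact: measurable_gpdf.
rewrite /std_normal /lebesgue !integral_mpowerS//; last 2 first.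
- by apply: emeasurable_funM => //; exact: mp.
- by move=> x; rewrite mule_ge0// lee_fin gpdf_ge0.
rewrite (@ge0_integral_density _ _ _ leb (normal_prob 0 1) (normal_pdf 0 1)); last 5 first.
- exact: measurable_normal_pdf.
- by move=> x; exact: normal_pdf_ge0.
- by [].
- exact: (@measurable_fun_fubini_tonelli_F _ _ _ _ _ (mpower (normal_prob 0 1) n) (f \o vcons)
    (measurableT_comp mf (@measurable_vcons R n)) (fun z => f0 _)).
- by move=> x; apply: integral_ge0 => v _; exact: f0.
apply: eq_integral => x _.
rewrite [X in (X * _)%E](IHn (fun v => f (vcons (x, v))))//; last first.
  exact: (measurableT_comp mf (measurable_vconsr _)).
rewrite -ge0_integralZr//; last 3 first.
- apply: emeasurable_funM; last exact: mp.
  exact: (measurableT_comp mf (measurable_vconsr _)).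
- by move=> v _; rewrite mule_ge0// lee_fin gpdf_ge0.
- by rewrite lee_fin normal_pdf_ge0.
apply: eq_integral => v _; rewrite -muleA -EFinM; congr (_ * _%:E)%E.
rewrite gpdf_vcons mulrC normal_pdfE ?oner_neq0// /normal_peak /normal_fun.
by rewrite subr0 !expr1n !mul1r mulNr.
Qed.

End gaussian_integrals.

(** * Gram matrices: orthogonal equivalence and square roots *)

Section gram_matrices.
Context {R : realType}.

Lemma mulmx_trE m n p (A : 'M[R]_(m, n)) (B : 'M[R]_(p, n)) i j :
  (A *m B^T) i j = \sum_l A i l * B j l.
Proof. by rewrite mxE; apply: eq_bigr => l _; rewrite mxE. Qed.

Lemma gram_eq0 n (v : 'rV[R]_n) : (v *m v^T) 0 0 = 0 -> v = 0.
Proof.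
rewrite mulmx_trE => /eqP; rewrite psumr_eq0; last first.
  by move=> i _; rewrite -expr2 sqr_ge0.
move=> /allP x0; apply/matrixP => i j; rewrite ord1 mxE.
by have := x0 j (mem_index_enum _); rewrite /= mulf_eq0 orbb => /eqP.
Qed.

Lemma gram_ge0 n (v : 'rV[R]_n) : 0 <= (v *m v^T) 0 0.
Proof. by rewrite mulmx_trE; apply: sumr_ge0 => i _; rewrite -expr2 sqr_ge0. Qed.

(* Q is a product of reflections, the q-th one carrying row q of B to row q of A;
   equality of the Gram matrices makes it fix the previous rows. *)
Lemma gram_orthogonal p m (A B : 'M[R]_(p, m)) : A *m A^T = B *m B^T ->
  exists Q : 'M[R]_m, Q^T *m Q = 1%:M /\ A = B *m Q.
Proof.
move=> AB.
suff: forall q, (q <= p)%N -> exists Q : 'M[R]_m, Q *m Q^T = 1%:M /\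
    forall i : 'I_p, (i < q)%N -> row i A = row i (B *m Q).
  move=> /(_ p (leqnn p)) [Q [QQ AQ]]; exists Q; split; first exact: mulmx1C.
  by apply/row_matrixP => i; exact: AQ.
elim=> [_|q IHq qp]; first by exists 1%:M; rewrite trmx1 mulmx1.
have [Q [QQ AQ]] := IHq (ltnW qp).
set B' := B *m Q in AQ.
have BB' : B' *m B'^T = A *m A^T.
  by rewrite /B' trmx_mul mulmxA -(mulmxA B) QQ mulmx1 AB.
pose i := Ordinal qp; pose a := row i A; pose b := row i B'.
pose v := b - a; pose c := (v *m v^T) 0 0.
have [c0|c0] := eqVneq c 0.
  exists Q; split=> // j; rewrite ltnS leq_eqVlt => /orP[/eqP ji|]; last exact: AQ.
  have -> : j = i by exact/val_inj.
  by apply/esym/eqP; rewrite -subr_eq0; apply/eqP; exact: gram_eq0.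
(* The Householder reflection in the hyperplane orthogonal to [v = b - a]. *)
pose H : 'M[R]_m := 1%:M - (2 / c) *: (v^T *m v).
have HT : H^T = H by rewrite /H linearB/= trmx1 linearZ/= trmx_mul trmxK.
have vv : v *m v^T = c%:M by rewrite [LHS]mx11_scalar.
have vvv : (v^T *m v) *m (v^T *m v) = c *: (v^T *m v).
  by rewrite mulmxA -(mulmxA v^T) vv mul_mx_scalar -scalemxAl.
have HH : H *m H = 1%:M.
  rewrite /H mulmxBr mulmx1 mulmxBl mul1mx -scalemxAr -scalemxAl vvv.
  by apply/matrixP => x y; rewrite !mxE; field.
have rowB (j k : 'I_p) : \sum_l B' j l * B' k l = \sum_l A j l * A k l.
  by rewrite -!mulmx_trE BB'.
exists (Q *m H); split.
  by rewrite trmx_mul HT mulmxA -(mulmxA Q) HH mulmx1.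
move=> j; rewrite ltnS leq_eqVlt => /orP[/eqP ji|jq].
  have -> : j = i by exact/val_inj.
  (* Equal Gram matrices give |a| = |b|, hence <b, v> = |v|^2 / 2, and the reflection sends [b] to
     [b - v = a]. *)
  have bv : b *m v^T = (c / 2)%:M.
    rewrite [LHS]mx11_scalar; congr _%:M; rewrite /c !mulmx_trE.
    have -> : \sum_l v 0 l * v 0 l = \sum_l B' i l * B' i l +
        \sum_l A i l * A i l - (\sum_l B' i l * A i l) *+ 2.
      rewrite -sumrMnl -big_split -sumrB; apply: eq_bigr => l _.
      by rewrite /v /a /b !mxE /=; ring.
    have half (S T : R) : (S + S - T *+ 2) / 2 = S - T by field.
    rewrite -rowB. rewrite half.
    rewrite -sumrB; apply: eq_bigr => l _; by rewrite /v /a /b !mxE; ring.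
  rewrite mulmxA row_mul /H mulmxBr mulmx1 -scalemxAr mulmxA -/b bv.
  rewrite mul_scalar_mx scalerA mulrA mulfVK// divff ?pnatr_eq0// scale1r.
  by rewrite /v opprB addrC subrK.
rewrite mulmxA row_mul /H mulmxBr mulmx1 -scalemxAr mulmxA -/B'.
suff -> : row j B' *m v^T = 0 by rewrite mul0mx scaler0 subr0; exact: AQ.
rewrite [LHS]mx11_scalar mulmx_trE.
have -> : \sum_l row j B' 0 l * v 0 l =
    \sum_l B' j l * B' i l - \sum_l A j l * A i l.
  rewrite -sumrB; apply: eq_bigr => l _; rewrite /v /a /b.
  have /rowP/(_ l) := AQ j jq; rewrite !mxE => ->; ring.
by rewrite rowB subrr raddf0.
Qed.

(** One Cholesky step per row: the first row contributes its norm and the inner products with it;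
    the other rows, projected off it, are handled by induction. A vanishing first row, which would
    be a zero pivot, is simply dropped. *)
Lemma gram_square_root p m (A : 'M[R]_(p, m)) :
  exists B : 'M[R]_p, B *m B^T = A *m A^T.
Proof.
elim: p A => [|p IHp] A; first by exists 0; apply/matrixP => -[].
suff main (d : 'M[R]_(1, m)) (A1 : 'M[R]_(p, m)) : exists B : 'M[R]_(1 + p),
    B *m B^T = col_mx d A1 *m (col_mx d A1)^T.
  have := main (usubmx (A : 'M[R]_(1 + p, m))) (dsubmx (A : 'M[R]_(1 + p, m))).
  by rewrite vsubmxK.
pose c := (d *m d^T) 0 0.
have c0 : 0 <= c by exact: gram_ge0.
have ddE : d *m d^T = c%:M by rewrite [LHS]mx11_scalar.
have AAE : col_mx d A1 *m (col_mx d A1)^T =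
    block_mx (d *m d^T) (d *m A1^T) (A1 *m d^T) (A1 *m A1^T).
  by rewrite tr_col_mx mul_col_row.
have [cz|cn0] := eqVneq c 0.
  have dz : d = 0 by exact: gram_eq0.
  have [B1 B1E] := IHp A1.
  exists (block_mx (0 : 'M[R]_1) 0 0 B1 : 'M[R]_(1 + p)).
  rewrite AAE tr_block_mx mulmx_block dz !trmx0 !mul0mx !mulmx0 !addr0 add0r.
  by rewrite B1E.
have cp : 0 < c by rewrite lt_def cn0.
have sc : Num.sqrt c != 0 by rewrite gt_eqF// sqrtr_gt0.
have ss : Num.sqrt c * Num.sqrt c = c by rewrite -expr2 sqr_sqrtr.
(* [N] is the orthogonal projection onto the complement of [d]. *)
pose N : 'M[R]_m := 1%:M - c^-1 *: (d^T *m d); pose A2 := A1 *m N.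
have NT : N^T = N by rewrite /N linearB/= trmx1 linearZ/= trmx_mul trmxK.
have PP : (d^T *m d) *m (d^T *m d) = c *: (d^T *m d).
  by rewrite mulmxA -(mulmxA d^T) ddE mul_mx_scalar -scalemxAl.
have NN : N *m N = N.
  rewrite {1 2}/N mulmxBr mulmx1 mulmxBl mul1mx -scalemxAr -scalemxAl PP.
  by rewrite !scalerA mulfVK// subrr subr0.
have [B2 B2E] := IHp A2.
exists (block_mx ((Num.sqrt c)%:M : 'M[R]_1) 0 ((Num.sqrt c)^-1 *: (A1 *m d^T)) B2
  : 'M[R]_(1 + p)).
rewrite AAE tr_block_mx mulmx_block trmx0 !mul0mx !mulmx0 !addr0.
rewrite tr_scalar_mx -scalar_mxM ss ddE; congr block_mx.
- rewrite linearZ/= -scalemxAr mul_scalar_mx scalerA mulVf// scale1r.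
  by rewrite trmx_mul trmxK.
- by rewrite mul_mx_scalar scalerA divff// scale1r.
- rewrite B2E /A2 trmx_mul NT mulmxA -(mulmxA A1) NN linearZ/= trmx_mul trmxK.
  rewrite -scalemxAr -scalemxAl scalerA -invfM ss.
  rewrite (_ : A1 *m d^T *m (d *m A1^T) = A1 *m (d^T *m d) *m A1^T); last first.
    by rewrite !mulmxA.
  by rewrite scalemxAl scalemxAr -mulmxDl -mulmxDr /N addrC subrK mulmx1.
Qed.

End gram_matrices.

(** * Gaussian laws as affine images of the standard normal law *)

Section gaussian_laws.
Context {R : realType}.

Lemma sqn_orthogonal n (Q : 'M[R]_n) x : Q^T *m Q = 1%:M -> sqn (Q *m x) = sqn x.
Proof. by move=> QQ; rewrite !sqnE trmx_mul -mulmxA (mulmxA _ Q) QQ mul1mx. Qed.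

Lemma gpdf_scale n (s t : R) (x : 'cV[R]_n) : 0 < s -> 0 < t ->
  gpdf (s ^+ 2 * t) (s *: x) * s ^+ n = gpdf t x.
Proof.
move=> s0 t0; rewrite /gpdf sqnZ -(mulrA (s ^+ 2)) sqrtrM ?sqr_ge0// sqrtr_sqr.
rewrite gtr0_norm// invfM exprMn !exprVn.
have -> : s ^+ 2 * sqn x / (s ^+ 2 * t *+ 2) = sqn x / (t *+ 2).
  by field; rewrite !gt_eqF.
have : s ^+ n != 0 by rewrite gt_eqF// exprn_gt0.
set b := Num.sqrt _ ^- n; set e := expR _.
by move: (s ^+ n) b e => a b e a0; field.
Qed.

Lemma measure_indicE d (T : measurableType d) (mu : {measure set T -> \bar R})
   (S : set T) : measurable S -> mu S = (\int[mu]_x (\1_S x)%:E)%E.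
Proof. by move=> mS; rewrite integral_indic// setIT. Qed.

Lemma indic_preimage (T1 T2 : Type) (f : T1 -> T2) (S : set T2) x :
  \1_(f @^-1` S) x = \1_S (f x) :> R.
Proof. by rewrite !indicE; congr (_%:R); apply/idP/idP; rewrite !inE. Qed.

Lemma measurable_preimage d1 d2 (T1 : measurableType d1) (T2 : measurableType d2)
    (f : T1 -> T2) (S : set T2) : measurable_fun setT f -> measurable S ->
  measurable (f @^-1` S).
Proof. by move=> mf mS; rewrite -[X in measurable X]setTI; exact: mf. Qed.

Lemma std_normal_orthogonal n (Q : 'M[R]_n) (S : set 'cV[R]_n) :
  Q^T *m Q = 1%:M -> measurable S ->
  std_normal n (mulmx Q @^-1` S) = std_normal n S.
Proof.
move=> QQ mS.
have mp : measurable_fun setT (fun x : 'cV[R]_n => (gpdf 1 x)%:E).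
  by apply/measurable_EFinP; exact: measurable_gpdf.
have mQ : measurable_fun setT (mulmx Q : 'cV[R]_n -> 'cV[R]_n).
  exact: measurable_mulmx.
have i0 (x : 'cV[R]_n) : (0 <= (\1_S x)%:E :> \bar R)%E by rewrite lee_fin indicE.
have uQ : Q \in unitmx by have [_ ->] := mulmx1_unit QQ.
rewrite (measure_indicE _ mS) (measure_indicE _ (measurable_preimage mQ mS)).
rewrite !integral_std_normal//; last 2 first.
- by apply/measurable_EFinP; exact: measurable_indic.
- apply/measurable_EFinP; exact: (measurableT_comp (measurable_indic mS) mQ).
rewrite [RHS](integral_lebesgue_linear uQ); last 2 first.
- apply: emeasurable_funM => //.
  by apply/measurable_EFinP; exact: measurable_indic.
- by move=> x; rewrite mule_ge0// lee_fin gpdf_ge0.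
have /(congr1 (fun M => \det M)) := QQ.
rewrite det_mulmx det_tr det1 -expr2 => /eqP; rewrite sqrf_eq1 => dQ.
have -> : `|\det Q| = 1.
  by case/orP: dQ => /eqP ->; rewrite ?normrN normr1.
rewrite mul1e; apply: eq_integral => x _.
by rewrite /gpdf sqn_orthogonal.
Qed.

Lemma vcons0 n (x : R) (v : 'cV[R]_n) (i : 'I_n.+1) :
  i = 0%N :> nat -> vcons (x, v) i 0 = x.
Proof.
move=> i0; have -> : i = lshift n (0 : 'I_1) by exact/val_inj.
by apply: etrans (@col_mxEu _ 1 n 1 _ _ 0 0) _; rewrite mxE.
Qed.

Lemma vconsS n (x : R) (v : 'cV[R]_n) (i : 'I_n.+1) (l : 'I_n) :
  i = l.+1 :> nat -> vcons (x, v) i 0 = v l 0.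
Proof.
move=> il; have -> : i = rshift 1 l by exact/val_inj.
exact: (@col_mxEd _ 1 n 1 _ _ l 0).
Qed.

Section padding.
Variable (P : probability (measurableTypeR R) R).

Lemma measurable_usubmx m q : measurable_fun setT (@usubmx R m q 1).
Proof.
apply: measurable_fun_mx => i j.
rewrite (_ : (fun x => _) = fun v : 'cV[R]_(m + q) => v (lshift q i) j).
  exact: measurable_entry.
by apply/funext => v /=; rewrite mxE.
Qed.

Lemma measurable_dsubmx m q : measurable_fun setT (@dsubmx R m q 1).
Proof.
apply: measurable_fun_mx => i j.
rewrite (_ : (fun x => _) = fun v : 'cV[R]_(m + q) => v (rshift m i) j).
  exact: measurable_entry.
by apply/funext => v /=; rewrite mxE.
Qed.

(** The discarded coordinates carry total mass 1 and integrate out. *)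
Lemma integral_mpower_usubmx m q (f : 'cV[R]_m -> \bar R) :
  measurable_fun setT f -> (forall x, 0 <= f x)%E ->
  (\int[mpower P (m + q)]_x f (usubmx x) = \int[mpower P m]_x f x)%E.
Proof.
elim: m f => [|m IHm] f mf f0.
  rewrite [RHS]/= integral_dirac// diracT mul1e.
  transitivity (\int[mpower P (0 + q)]_x (cst (f (0 : 'cV[R]_0)%R) x))%E.
    by apply: eq_integral => x _; congr f; apply/matrixP => -[].
  by rewrite integral_cst// [X in (_ * X)%E](mpowerT P) mule1.
rewrite (@integral_mpowerS _ P (m + q) (fun x => f (@usubmx _ m.+1 q 1 x)))//; last first.
  exact: (measurableT_comp mf (@measurable_usubmx m.+1 q)).
rewrite integral_mpowerS//; apply: eq_integral => x _.
rewrite -(IHm (fun v => f (vcons (x, v))))//; last first.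
  exact: (measurableT_comp mf (measurable_vconsr _)).
apply: eq_integral => v _; congr f.
apply/matrixP => i j; rewrite ord1 mxE.
case: (split_ordP (i : 'I_(1 + m))) => l il.
  by rewrite !vcons0// il/= ord1.
by rewrite (vconsS _ _ (l := lshift q l)) ?(vconsS _ _ (l := l)) ?il// mxE.
Qed.

Lemma integral_mpower_dsubmx m q (f : 'cV[R]_q -> \bar R) :
  measurable_fun setT f -> (forall x, 0 <= f x)%E ->
  (\int[mpower P (m + q)]_x f (dsubmx x) = \int[mpower P q]_x f x)%E.
Proof.
move=> mf f0; elim: m => [|m IHm].
  apply: eq_integral => x _; congr f; apply/matrixP => i j; rewrite mxE ord1.
  by congr (x _ _); exact/val_inj.
rewrite (@integral_mpowerS _ P (m + q) (fun x => f (@dsubmx _ m.+1 q 1 x)))//; last first.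
  exact: (measurableT_comp mf (@measurable_dsubmx m.+1 q)).
transitivity (\int[P]_x (\int[mpower P q]_v f v))%E.
  apply: eq_integral => x _; rewrite -IHm; apply: eq_integral => v _; congr f.
  apply/matrixP => i j; rewrite ord1 [LHS]mxE [RHS]mxE.
  exact: (@vconsS (m + q) x v _ (rshift m i)).
have q0 : (0 <= \int[mpower P q]_v f v)%E by apply: integral_ge0.
rewrite (_ : (fun x => _) = cst (\int[mpower P q]_v f v)%E)//.
by rewrite integral_cst// [X in (_ * X)%E](probability_setT P) mule1.
Qed.

End padding.

(* The two square roots of the covariance are padded with zero columns to a
   common size m + p, where they differ by an orthogonal matrix. *)
Lemma gaussianE p m (mu : 'cV[R]_p) (A : 'M[R]_(p, m)) (S : set 'cV[R]_p) :
  measurable S ->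
  gaussian mu (A *m A^T) S = std_normal m (affine mu A @^-1` S).
Proof.
move=> mS; rewrite /gaussian /distribution /pushforward.
set B := mxroot _.
(* [mxroot] falls back on 0 when no square root exists; [gram_square_root] rules this default
   out. *)
have BE : B *m B^T = A *m A^T.
  by have [C CE] := gram_square_root A; rewrite /B /mxroot; case: xgetP => [_ _ //|/(_ C)].
pose A' := row_mx A (0 : 'M[R]_(p, p)); pose B' := row_mx (0 : 'M[R]_(p, m)) B.
have AB' : A' *m A'^T = B' *m B'^T.
  by rewrite !tr_row_mx !mul_row_col !trmx0 !mulmx0 addr0 add0r BE.
have [Q [QQ A'E]] := gram_orthogonal AB'.
have mA := @measurable_affine R _ _ mu A.
have mB := @measurable_affine R _ _ mu B.
have mA' := @measurable_affine R _ _ mu A'.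
have mB' := @measurable_affine R _ _ mu B'.
have -> : std_normal m (affine mu A @^-1` S) = std_normal (m + p) (affine mu A' @^-1` S).
  rewrite (measure_indicE _ (measurable_preimage mA mS)).
  rewrite (measure_indicE _ (measurable_preimage mA' mS)).
  rewrite /std_normal -(integral_mpower_usubmx _ p); last 2 first.
  - by apply/measurable_EFinP/measurable_indic; exact: (measurable_preimage mA mS).
  - by move=> x; rewrite lee_fin indicE.
  apply: eq_integral => x _; rewrite !indic_preimage; congr ((\1_S _)%:E).
  by rewrite /affine /A' -[x in RHS]vsubmxK mul_row_col mul0mx addr0.
transitivity (std_normal (m + p) (affine mu B' @^-1` S)).
  apply: etrans (measure_indicE _ (measurable_preimage mB mS)) _.
  rewrite (measure_indicE _ (measurable_preimage mB' mS)).
  rewrite /std_normal -(integral_mpower_dsubmx _ m); last 2 first.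
  - by apply/measurable_EFinP/measurable_indic; exact: (measurable_preimage mB mS).
  - by move=> x; rewrite lee_fin indicE.
  apply: eq_integral => x _; rewrite !indic_preimage; congr ((\1_S _)%:E).
  by rewrite /affine /B' -[x in RHS]vsubmxK mul_row_col mul0mx add0r.
rewrite -(std_normal_orthogonal QQ (measurable_preimage mB' mS)).
congr (std_normal _ _); apply/funext => x /=.
by rewrite /affine A'E mulmxA.
Qed.

Lemma gaussian_scalarE n (s : R) (m : 'cV[R]_n) (S : set 'cV[R]_n) :
  0 < s -> measurable S ->
  (gaussian m (s ^+ 2)%:M S =
   \int[lebesgue n]_(y in S) (gpdf (s ^+ 2) (y - m))%:E)%E.
Proof.
move=> s0 mS.
have -> : (s ^+ 2)%:M = s%:M *m (s%:M)^T :> 'M[R]_n.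
  by rewrite tr_scalar_mx -scalar_mxM expr2.
have mA := @measurable_affine R _ _ m s%:M.
rewrite gaussianE// (measure_indicE _ (measurable_preimage mA mS)).
rewrite integral_std_normal; last 2 first.
- by apply/measurable_EFinP/measurable_indic; exact: (measurable_preimage mA mS).
- by move=> x; rewrite lee_fin indicE.
rewrite [RHS]integral_mkcond; set h := patch _ _ _.
have hE x : h x = ((\1_S x)%:E * (gpdf (s ^+ 2) (x - m))%:E)%E.
  by rewrite /h epatch_indic muleC.
have h0 x : (0 <= h x)%E by rewrite hE mule_ge0// lee_fin ?indicE// gpdf_ge0.
have mh : measurable_fun setT h.
  rewrite (_ : h = fun x => ((\1_S x)%:E * (gpdf (s ^+ 2) (x - m))%:E)%E); last exact/funext.
  apply: emeasurable_funM; first by apply/measurable_EFinP; exact: measurable_indic.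
  apply/measurable_EFinP; apply: measurableT_comp; first exact: measurable_gpdf.
  exact: measurable_addmx.
rewrite [RHS](integral_lebesgue_translate m)//.
have us : (s%:M : 'M[R]_n) \in unitmx.
  by rewrite unitmxE det_scalar unitrX// unitfE gt_eqF.
rewrite [RHS](integral_lebesgue_linear us)//; last first.
  exact: (measurableT_comp mh (measurable_addmx m)).
rewrite det_scalar ger0_norm ?exprn_ge0 ?(ltW s0)// -ge0_integralZl//; last 2 first.
- exact: (measurableT_comp (measurableT_comp mh (measurable_addmx m))
    (measurable_mulmx _)).
- by rewrite lee_fin exprn_ge0// ltW.
apply: eq_integral => x _; rewrite hE addrK mul_scalar_mx.
rewrite [RHS]muleCA; congr (_ * _)%E.
  by rewrite indic_preimage /affine mul_scalar_mx addrC.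
by rewrite -EFinM -[s ^+ 2]mulr1 mulrC gpdf_scale.
Qed.

End gaussian_laws.

(** * The posterior *)

Section rational_orthants.
Context {R : realType} {p : nat}.

(** A countable pi-system generating the sigma-algebra; countability is what allows one null set to
    serve every event. *)
Definition rat_orthant (q : 'cV[rat]_p) : set 'cV[R]_p :=
  [set v | forall i, v i 0 < ratr (q i 0)].

Lemma measurable_rat_orthant q : measurable (rat_orthant q).
Proof.
rewrite (_ : rat_orthant q = \bigcap_(i in [set: 'I_p])
    ((fun v : 'cV[R]_p => v i 0) @^-1` `]-oo, (ratr (q i 0) : R)[%classic)).
  apply: fin_bigcap_measurable => // i _.
  apply: measurable_preimage; first exact: measurable_entry.
  exact: measurable_itv.
by apply/seteqP; split => v /= vq i; [move=> _|]; have := vq i; rewrite ?in_itv/= //; apply.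
Qed.

Lemma sigma_rat_orthant :
  @measurable _ 'cV[R]_p = <<s [set rat_orthant q | q in setT] >>.
Proof.
apply/seteqP; split.
  pose T := g_sigma_algebraType [set rat_orthant q | q in setT].
  apply: smallest_sub; first exact: smallest_sigma_algebra.
  move=> _ [i [j [A [mA ->]]]].
  have mT : measurable_fun [set: T] (fun M : 'cV[R]_p => M i j).
    apply: (measurability _ (RGenInftyO.measurableE R)) => _ [_ [x ->] <-].
    rewrite setTI ord1.
    (* A half-space in coordinate [i] is the union of the orthants whose corner has [i]-th entry at
       most [x]: for a given [v], that entry is chosen between [v i 0] and [x], the others anywhere
       above [v]. *)
    rewrite (_ : _ @^-1` _ = \bigcup_(q : 'cV[rat]_p)
        (if (ratr (q i 0) <= x) then rat_orthant q else set0)).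
      apply: (@countable_bigcupT_measurable _ T); first exact: countableP.
      move=> q; case: ifPn => // _.
      by apply: sub_sigma_algebra; exists q.
    apply/seteqP; split => v /=; rewrite in_itv/=.
      move=> vx; have /rat_in_itvoo[r] := vx; rewrite in_itv/= => /andP[vr rx].
      have rat_above (y : R) : exists r : rat, y < ratr r.
        have /rat_in_itvoo[r'] : y < y + 1 by rewrite ltrDl.
        by rewrite in_itv/= => /andP[yr' _]; exists r'.
      have /choice[f fP] : forall l : 'I_p, exists r : rat, v l 0 < ratr r by move=> l.
      exists (\col_l if l == i then r else f l) => //.
      rewrite mxE eqxx (ltW rx) => l; rewrite mxE.
      by case: eqP => [->|].
    by move=> [q _]; case: ifPn => // qx vq; exact: lt_le_trans (vq i) qx.
  by rewrite -[X in <<s _ >> X]setTI; exact: mT.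
apply: smallest_sub; first exact: sigma_algebra_measurable.
by move=> _ [q _ <-]; exact: measurable_rat_orthant.
Qed.

(** Uniqueness on a pi-system: orthants intersect in the orthant of the coordinatewise minimum, and
    those with constant corner [k] exhaust the space. *)
Lemma eq_measure_rat_orthant (m1 m2 : {measure set 'cV[R]_p -> \bar R}) :
  (m1 setT < +oo)%E -> (forall q, m1 (rat_orthant q) = m2 (rat_orthant q)) ->
  forall A, measurable A -> m1 A = m2 A.
Proof.
move=> m1oo m12 A mA.
apply: (measure_unique [set rat_orthant q | q in setT]
  (fun k => rat_orthant (const_mx k%:R))) => //.
- exact: sigma_rat_orthant.
- move=> _ _ [q _ <-] [r _ <-].
  exists (\col_i Order.min (q i 0) (r i 0)) => //.
  apply/seteqP; split => v /= => [vq|[vq vr] i].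
    split=> i; have := vq i; rewrite mxE; move/lt_le_trans; apply;
      by rewrite ler_rat ge_min lexx ?orbT.
  by rewrite mxE /Order.min; case: ifPn.
- apply/seteqP; split => // v _.
  have [N vN] : exists N : nat, forall i, v i 0 < N%:R.
    exists (\sum_i (Num.truncn `|v i (0 : 'I_1)%R|).+1)%N => i.
    apply: (@lt_le_trans _ _ (Num.truncn `|v i 0|).+1%:R).
      by rewrite (le_lt_trans (ler_norm _))// truncnS_gt.
    by rewrite ler_nat (bigD1 i)//= leq_addr.
  by exists N => // i; rewrite mxE ratr_nat.
- by move=> _ [q _ <-].
- move=> k; apply: le_lt_trans m1oo; apply: le_measure => //; rewrite inE//.
  exact: measurable_rat_orthant.
Qed.

End rational_orthants.

Section density_measure.
Context d (T : measurableType d) (R : realType).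
Variables (mu : {measure set T -> \bar R}) (f : T -> R).
Hypotheses (mf : measurable_fun setT f) (f0 : forall x, 0 <= f x).
Local Open Scope ereal_scope.

(** The hypotheses on [f] are arguments so that the term itself carries what its measure structure
    needs. *)
Definition density_measure of measurable_fun setT f & (forall x, 0 <= f x)%R :=
  fun A : set T => \int[mu]_(x in A) (f x)%:E.

Local Notation dm := (density_measure mf f0).

Let dm0 : dm set0 = 0. Proof. exact: integral_set0. Qed.

Let dm_ge0 A : 0 <= dm A.
Proof. by apply: integral_ge0 => x _; rewrite lee_fin. Qed.

Let dm_sigma_additive : semi_sigma_additive dm.
Proof.
move=> A mA tA mUA; rewrite /density_measure ge0_integral_bigcup//.
- apply: is_cvg_ereal_nneg_natsum_cond => n _ _; exact: dm_ge0.
- exact/measurable_funTS/measurable_EFinP.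
- by move=> x _; rewrite lee_fin.
Qed.

HB.instance Definition _ := isMeasure.Build _ _ _ dm dm0 dm_ge0 dm_sigma_additive.

End density_measure.

(** * Bayes formula for an arbitrary version of the posterior *)

Section posterior.
Context {R : realType} {n k p : nat}.
Variables (H : 'M[R]_(n, k)) (v : 'cV[R]_k -> R) (W : probability 'cV[R]_n R).
Hypotheses (mv : measurable_fun setT v) (v0 : forall z, 0 <= v z).
Hypothesis WE : forall A : set 'cV[R]_n, measurable A ->
  (W A = \int[lebesgue k]_(z in mulmx H @^-1` A) (v z)%:E)%E.
Variables (s : R) (G : 'M[R]_(p, n)) (K : R.-pker 'cV[R]_n ~> 'cV[R]_p).
Hypotheses (s0 : 0 < s) (posteriorK : is_posterior W s G K).
Local Open Scope ereal_scope.

Lemma integral_prior (g : 'cV[R]_n -> \bar R) :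
  measurable_fun setT g -> (forall x, 0 <= g x) ->
  \int[W]_f g f = \int[lebesgue k]_z (g (H *m z) * (v z)%:E).
Proof.
move=> mg g0.
pose V := density_measure (lebesgue k) mv v0.
have mH : measurable_fun setT (mulmx H : 'cV[R]_k -> 'cV[R]_n).
  exact: measurable_mulmx.
transitivity (\int[image_measure V mH]_f g f).
  by apply: eq_measure_integral => A mA _; rewrite /= WE.
rewrite ge0_integral_pushforward//= preimage_setT.
rewrite (@ge0_integral_density _ _ _ (lebesgue k) V v)//.
exact: measurableT_comp mg mH.
Qed.

Let lik (y : 'cV[R]_n) (z : 'cV[R]_k) : R := (v z * gpdf (s ^+ 2) (y - H *m z))%R.

Let lik0 y z : (0 <= lik y z)%R. Proof. by rewrite mulr_ge0// gpdf_ge0. Qed.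

Let mlik : measurable_fun setT (fun yz : 'cV[R]_n * 'cV[R]_k => lik yz.1 yz.2).
Proof.
apply: measurable_funM; first exact: (measurableT_comp mv (@measurable_snd _ _ _ _)).
apply: (measurableT_comp (@measurable_gpdf R n _)).
apply: measurable_fun_mx => i j.
rewrite (_ : (fun x => _) = fun x : 'cV[R]_n * 'cV[R]_k =>
   (x.1 i j - (H *m x.2) i j)%R); last by apply/funext => x; rewrite !mxE.
apply: measurable_funB.
  exact: (measurableT_comp (measurable_entry i j) (@measurable_fst _ _ _ _)).
exact: (measurableT_comp (measurableT_comp (measurable_entry i j)
  (measurable_mulmx H)) (@measurable_snd _ _ _ _)).
Qed.

(* The density at y of the subprobability P(Y in dy, G F in B). *)
Definition joint_mass (B : set 'cV[R]_p) (y : 'cV[R]_n) : \bar R :=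
  \int[lebesgue k]_z (\1_B (G *m (H *m z)) * lik y z)%:E.

Let mGH : measurable_fun setT (fun z : 'cV[R]_k => G *m (H *m z)).
Proof. exact: (measurableT_comp (measurable_mulmx G) (measurable_mulmx H)). Qed.

Let mjoint B : measurable B ->
  measurable_fun setT (fun yz : 'cV[R]_n * 'cV[R]_k =>
    (\1_B (G *m (H *m yz.2)) * lik yz.1 yz.2)%:E).
Proof.
move=> mB; apply/measurable_EFinP; apply: measurable_funM => //.
exact: (measurableT_comp (measurable_indic mB)
  (measurableT_comp mGH (@measurable_snd _ _ _ _))).
Qed.

Lemma joint_mass_ge0 B y : 0 <= joint_mass B y.
Proof.
by apply: integral_ge0 => z _; rewrite lee_fin mulr_ge0// indicE.
Qed.

Lemma measurable_joint_mass B : measurable B -> measurable_fun setT (joint_mass B).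
Proof.
move=> mB.
apply: (@measurable_fun_fubini_tonelli_F _ _ _ _ _ (lebesgue k) _ (mjoint mB)).
by move=> z; rewrite lee_fin mulr_ge0// indicE.
Qed.

(** Tonelli with a free weight: [phi] = 1_A yields the left side of the posterior identity, and
    [phi] = 1_A K(., B), with the full event in place of [B], the right side. *)
Lemma integral_prior_likelihood (phi : 'cV[R]_n -> \bar R) B :
  measurable B -> measurable_fun setT phi -> (forall y, 0 <= phi y) ->
  \int[W]_f ((\1_B (G *m f))%:E * \int[gaussian f (s ^+ 2)%:M]_y phi y) =
  \int[lebesgue n]_y (phi y * joint_mass B y).
Proof.
move=> mB mphi phi0.
pose Lf f := \int[lebesgue n]_y (phi y * (gpdf (s ^+ 2) (y - f))%:E).
have mg : measurable_fun setT (fun fy : 'cV[R]_n * 'cV[R]_n =>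
    phi fy.2 * (gpdf (s ^+ 2) (fy.2 - fy.1))%:E).
  apply: emeasurable_funM.
    exact: (measurableT_comp mphi (@measurable_snd _ _ _ _)).
  apply/measurable_EFinP.
  exact: (measurableT_comp (@measurable_gpdf R n _) (@measurable_subr2 R n)).
have g0 f y : 0 <= phi y * (gpdf (s ^+ 2) (y - f))%:E.
  by rewrite mule_ge0// lee_fin gpdf_ge0.
have mL : measurable_fun setT Lf.
  by apply: (@measurable_fun_fubini_tonelli_F _ _ _ _ _ (lebesgue n) _ mg) => z.
have L0 f : 0 <= Lf f by apply: integral_ge0 => y _; exact: g0.
transitivity (\int[W]_f ((\1_B (G *m f))%:E * Lf f)).
  apply: eq_integral => f _; congr (_ * _); rewrite /Lf.
  apply: (@ge0_integral_density _ _ _ (lebesgue n) _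
    (fun y => gpdf (s ^+ 2) (y - f)%R)) => //.
  - exact: (measurableT_comp (@measurable_gpdf R n _) (measurable_addmx _)).
  - by move=> y; exact: gpdf_ge0.
  - by move=> A mA; exact: gaussian_scalarE.
rewrite integral_prior; last 2 first.
- apply: emeasurable_funM => //; apply/measurable_EFinP.
  exact: (measurableT_comp (measurable_indic mB) (measurable_mulmx G)).
- by move=> f; rewrite mule_ge0// lee_fin indicE.
transitivity (\int[lebesgue k]_z \int[lebesgue n]_y
    (phi y * (\1_B (G *m (H *m z)) * lik y z)%:E)).
  apply: eq_integral => z _; rewrite muleAC -EFinM /Lf -ge0_integralZl//; last 2 first.
  - exact: (measurableT_comp mg (pair1_measurable (H *m z))).
  - by rewrite lee_fin mulr_ge0// indicE.
  apply: eq_integral => y _; rewrite muleCA -EFinM; congr (_ * _%:E).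
  exact/esym/mulrA.
have mF : measurable_fun setT (fun zy : 'cV[R]_k * 'cV[R]_n =>
    phi zy.2 * (\1_B (G *m (H *m zy.1)) * lik zy.2 zy.1)%:E).
  apply: emeasurable_funM.
    exact: (measurableT_comp mphi (@measurable_snd _ _ _ _)).
  exact: (measurableT_comp (mjoint mB) (@measurable_swap _ _ _ _)).
have j0 y z : 0 <= (\1_B (G *m (H *m z)) * lik y z)%:E.
  by rewrite lee_fin mulr_ge0// indicE.
rewrite (@fubini_tonelli _ _ _ _ _ (lebesgue k) (lebesgue n) _ mF); last first.
  by move=> z; rewrite mule_ge0.
apply: eq_integral => y _ /=; rewrite ge0_integralZl//.
exact: (measurableT_comp (mjoint mB) (pair1_measurable y)).
Qed.

(** The posterior identity carried over to Lebesgue measure in y, where equality over every [A]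
    gives equality almost everywhere. *)
Lemma joint_massP A B : measurable A -> measurable B ->
  \int[lebesgue n]_(y in A) joint_mass B y =
  \int[lebesgue n]_(y in A) (K y B * joint_mass setT y).
Proof.
move=> mA mB.
have mK : measurable_fun setT (K ^~ B) by exact: measurable_kernel.
have mA1 : measurable_fun setT (fun y : 'cV[R]_n => (\1_A y)%:E : \bar R).
  by apply/measurable_EFinP; exact: measurable_indic.
have := posteriorK mA mB.
have -> : \int[W]_(f in mulmx G @^-1` B) gaussian f (s ^+ 2)%:M A =
    \int[lebesgue n]_(y in A) joint_mass B y.
  rewrite [RHS]integral_mkcond epatch_indic.
  transitivity (\int[lebesgue n]_y ((\1_A y)%:E * joint_mass B y)); last first.
    by apply: eq_integral => y _; rewrite muleC.
  rewrite -integral_prior_likelihood//.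
  rewrite integral_mkcond epatch_indic; apply: eq_integral => f _.
  by rewrite muleC indic_preimage -measure_indicE.
move=> ->.
rewrite [RHS]integral_mkcond epatch_indic.
transitivity (\int[lebesgue n]_y (((\1_A y)%:E * K y B) * joint_mass setT y)); last first.
  by apply: eq_integral => y _; rewrite /= [RHS]muleC muleA.
rewrite -integral_prior_likelihood//; last exact: emeasurable_funM.
apply: eq_integral => f _; rewrite indicE in_setT mul1e.
by rewrite integral_mkcond epatch_indic; apply: eq_integral => y _; rewrite muleC.
Qed.

Lemma integral_joint_massT : \int[lebesgue n]_y joint_mass setT y = 1.
Proof.
transitivity (\int[lebesgue n]_y (cst 1 y * joint_mass setT y)).
  by apply: eq_integral => y _; rewrite mul1e.
rewrite -integral_prior_likelihood//.
transitivity (\int[W]_f (cst 1 f : \bar R)); last first.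
  by rewrite integral_cst// mul1e; exact: probability_setT.
apply: eq_integral => f _; rewrite indicE in_setT mul1e.
by rewrite integral_cst// mul1e; exact: probability_setT.
Qed.

(** The quantifier over [B] stands inside the almost-everywhere statement. The formula holds off one
    null set for all rational orthants, and there it extends to all events as an equality of two
    finite measures. Written as a product, it needs no positivity of the marginal density. *)
Lemma posterior_ae : {ae lebesgue n, forall y, joint_mass setT y < +oo /\
  forall B, measurable B -> joint_mass B y = K y B * joint_mass setT y}.
Proof.
have intT : (lebesgue n).-integrable setT (joint_mass setT).
  apply/integrableP; split; first exact: measurable_joint_mass.
  under eq_integral do rewrite gee0_abs ?joint_mass_ge0//.
  by rewrite integral_joint_massT ltry.
have int B : measurable B -> (lebesgue n).-integrable setT (joint_mass B).
  move=> mB; apply: (le_integrable _ _ _ intT) => //; first exact: measurable_joint_mass.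
  move=> y _; rewrite !gee0_abs ?joint_mass_ge0//.
  apply: ge0_le_integral => //.
  - by move=> z _; rewrite lee_fin mulr_ge0// indicE.
  - exact: (measurableT_comp (mjoint mB) (pair1_measurable y)).
  - exact: (measurableT_comp (mjoint measurableT) (pair1_measurable y)).
  - by move=> z _; rewrite lee_fin ler_wpM2r// !indicE in_setT ler_nat leq_b1.
have aeB B : measurable B -> {ae lebesgue n, forall y,
    joint_mass B y = K y B * joint_mass setT y}.
  move=> mB.
  have : ae_eq (lebesgue n) setT (joint_mass B) (fun y => K y B * joint_mass setT y).
    apply: integral_ae_eq => //; first exact: int.
      apply: emeasurable_funM; first exact: measurable_kernel.
      exact: measurable_joint_mass.
    by move=> A _ mA; exact: joint_massP.
  by apply: filterS => y; apply.
have aefin := integrable_ae measurableT intT.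
(* Corners are indexed by their codes, so that a countable intersection over [nat] covers them
   all. *)
have aeq : {ae lebesgue n, forall y, forall i : nat, forall q : 'cV[rat]_p,
    unpickle i = Some q ->
    joint_mass (rat_orthant q) y = K y (rat_orthant q) * joint_mass setT y}.
  apply: ae_foralln => i; case: (unpickle i) => [q|]; last first.
    by apply: aeW => y q.
  have := aeB _ (measurable_rat_orthant q).
  by apply: filterS => y yq _ [<-].
move: aefin aeq; apply: filterS2 => y fy yq.
have fy' : joint_mass setT y \is a fin_num by exact: fy.
split; first by rewrite ltey_eq fy'.
have mliky : measurable_fun setT (lik y).
  exact: (measurableT_comp mlik (pair1_measurable y)).
pose V := density_measure (lebesgue k) mliky (lik0 y).
pose m1 := image_measure V mGH.
have r0 : (0 <= fine (joint_mass setT y))%R by rewrite fine_ge0// joint_mass_ge0.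
pose m2 := mscale (NngNum r0) (K y).
have m1E B : m1 B = joint_mass B y.
  rewrite /m1 /= /pushforward /V /density_measure /joint_mass.
  rewrite integral_mkcond epatch_indic; apply: eq_integral => z _ /=.
  by rewrite indic_preimage muleC.
have m2E B : m2 B = K y B * joint_mass setT y.
  by rewrite /m2 /= /mscale/= fineK// muleC.
move=> B mB; rewrite -m1E -m2E; apply: eq_measure_rat_orthant => //.
- by rewrite /= m1E ltey_eq fy'.
- by move=> q; rewrite [LHS]m1E [RHS]m2E (yq (pickle q))// pickleK.
Qed.

End posterior.

(** * Total variation distance to the Gaussian limit *)

Section key_inequality.
Context {R : realType}.

(** Pythagoras: the residual of [y] is orthogonal to the range of [D]. *)
Lemma isometry_sqn n k (D : 'M[R]_(n, k)) (y : 'cV[R]_n) (z : 'cV[R]_k) :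
  D^T *m D = 1%:M ->
  sqn (y - D *m z) = sqn (y - D *m (D^T *m y)) + sqn (z - D^T *m y).
Proof.
move=> DD; set a := y - D *m (D^T *m y); set b := z - D^T *m y.
have Da : D^T *m a = 0 by rewrite /a mulmxBr (mulmxA D^T) DD mul1mx subrr.
have aD : a^T *m D = 0 by rewrite -[LHS]trmxK trmx_mul trmxK Da trmx0.
have -> : y - D *m z = a - D *m b.
  by rewrite /a /b mulmxBr opprB addrA subrK.
move: Da aD; clearbody a b => Da aD.
have tE : (a - D *m b)^T = a^T - b^T *m D^T by rewrite linearB/= trmx_mul.
rewrite !sqnE tE mulmxBl !mulmxBr !mulmxA aD mul0mx subr0.
rewrite -!mulmxA Da mulmx0 sub0r opprK (mulmxA D^T) DD mul1mx.
by rewrite mxE.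
Qed.

(** [C] absorbs the distance from [y] to the range of [D]; being independent of [z], it cancels in
    the posterior. *)
Lemma gpdf_isometry n k (D : 'M[R]_(n, k)) (s : R) (y : 'cV[R]_n) :
  D^T *m D = 1%:M -> 0 < s -> exists2 C, 0 < C & forall z,
    gpdf (s ^+ 2) (y - (s *: D) *m z) = C * gpdf 1 (z - s^-1 *: (D^T *m y)).
Proof.
move=> DD s0.
pose c : R := (Num.sqrt (1 * (pi *+ 2)))^-1 ^+ k.
have sp (t : R) : 0 < t -> 0 < (Num.sqrt (t * (pi *+ 2)))^-1.
  by move=> t0; rewrite invr_gt0 sqrtr_gt0 mulr_gt0// mulrn_wgt0// pi_gt0.
have c0 : 0 < c by rewrite exprn_gt0// sp.
exists ((Num.sqrt (s ^+ 2 * (pi *+ 2)))^-1 ^+ n *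
  expR (- (sqn (y - D *m (D^T *m y)) / (s ^+ 2 *+ 2))) / c).
  by rewrite divr_gt0// mulr_gt0 ?expR_gt0// exprn_gt0// sp// exprn_gt0.
move=> z; rewrite /gpdf -scalemxAl scalemxAr (isometry_sqn _ (s *: z) DD).
have -> : s *: z - D^T *m y = s *: (z - s^-1 *: (D^T *m y)).
  by rewrite scalerBr scalerA divff ?gt_eqF// scale1r.
rewrite sqnZ mulrDl opprD expRD -/c -!mulrA (mulKf (lt0r_neq0 c0)).
congr (_ * (_ * expR (- _))); field; exact: lt0r_neq0.
Qed.

(* Completing the square: the product is N(0, 2)-density at w times the
   N(w / 2, 1 / 2)-density at u. *)
Lemma gpdf_convolution k (w : 'cV[R]_k) :
  (\int[lebesgue k]_u (gpdf 1 (w - u) * gpdf 1 u)%:E = (gpdf 2 w)%:E)%E.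
Proof.
transitivity (\int[lebesgue k]_u
   ((gpdf 2 w)%:E * (gpdf (2^-1) (u - 2^-1 *: w))%:E))%E.
  apply: eq_integral => u _; rewrite -EFinM; congr EFin.
  rewrite /gpdf mulrACA [in RHS]mulrACA -!exprMn -!invfM -!expRD.
  have tp (t : R) : 0 <= t -> 0 <= t * (pi *+ 2).
    by move=> t0; rewrite mulr_ge0// mulrn_wge0// pi_ge0.
  rewrite -!sqrtrM; [|exact: tp..].
  congr ((Num.sqrt _)^-1 ^+ _ * expR _); first by field.
  rewrite /sqn !mulr_suml -!sumrN -!big_split/=; apply: eq_bigr => i _.
  by rewrite !mxE; field.
rewrite ge0_integralZl ?integral_gpdf ?mule1//.
- by apply/measurable_EFinP; exact: (measurableT_comp (@measurable_gpdf R k _)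
    (measurable_addmx _)).
- by move=> z _; rewrite lee_fin gpdf_ge0.
- by rewrite lee_fin gpdf_ge0.
Qed.

(** A possibly singular Gaussian law becomes an integral over R^k against a genuine density,
    directly comparable with [joint_mass]. *)
Lemma affine_gaussian_law p k (A : 'M[R]_(p, k)) (x : 'cV[R]_k) B : measurable B ->
  (gaussian (A *m x) (A *m A^T) B =
    \int[lebesgue k]_z (\1_B (A *m z) * gpdf 1 (z - x))%:E)%E.
Proof.
move=> mB; have mA := measurable_affine (A *m x) A.
have mBA : measurable_fun setT (fun z : 'cV[R]_k => (\1_B (A *m z))%:E : \bar R).
  by apply/measurable_EFinP; exact: (measurableT_comp (measurable_indic mB)
    (measurable_mulmx A)).
have mg : measurable_fun setT (fun z : 'cV[R]_k => (gpdf 1 (z - x))%:E).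
  by apply/measurable_EFinP; exact: (measurableT_comp (@measurable_gpdf R k _)
    (measurable_addmx _)).
rewrite gaussianE// (measure_indicE _ (measurable_preimage mA mB)).
rewrite integral_std_normal; last 2 first.
- by apply/measurable_EFinP/measurable_indic; exact: (measurable_preimage mA mB).
- by move=> z; rewrite lee_fin indicE.
rewrite [RHS](integral_lebesgue_translate x); last 2 first.
- by under eq_fun do rewrite EFinM; exact: emeasurable_funM.
- by move=> z; rewrite lee_fin mulr_ge0 ?gpdf_ge0// indicE.
apply: eq_integral => z _; rewrite -EFinM addrK indic_preimage /affine.
by rewrite mulmxDr addrC.
Qed.

(* The integral of a nonnegative function is a supremum over simple functions
   below it, hence monotone even without measurability; the total variation
   distance, a supremum over all events, is not known to be measurable. *)
Lemma ge0_le_integral_nonmeasurable d (T : measurableType d)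
    (mu : {measure set T -> \bar R}) (f g : T -> \bar R) :
  (forall x, 0 <= f x)%E -> (forall x, f x <= g x)%E ->
  (\int[mu]_x f x <= \int[mu]_x g x)%E.
Proof.
move=> f0 fg; have g0 x : (0 <= g x)%E by exact: le_trans (fg x).
rewrite !ge0_integralTE//; apply: le_ereal_sup => _ [h hf <-].
by exists h => // x; exact: le_trans (fg x).
Qed.

Section posterior_tv.
Variables (n k p : nat) (D : 'M[R]_(n, k)) (v : 'cV[R]_k -> R).
Variables (W : probability 'cV[R]_n R) (s : R).
Variables (G : 'M[R]_(p, n)) (K : R.-pker 'cV[R]_n ~> 'cV[R]_p) (c : R).
Hypotheses (DD : D^T *m D = 1%:M) (s0 : 0 < s) (c0 : 0 < c).
Hypotheses (mv : measurable_fun setT v) (v0 : forall z, 0 <= v z).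
Hypothesis WE : forall A : set 'cV[R]_n, measurable A ->
  (W A = \int[lebesgue k]_(z in mulmx (s *: D) @^-1` A) (v z)%:E)%E.
Hypothesis posteriorK : is_posterior W s G K.
Local Open Scope ereal_scope.

Let center (y : 'cV[R]_n) : 'cV[R]_k := (s^-1 *: (D^T *m y))%R.

Definition prior_oscillation (x : 'cV[R]_k) : \bar R :=
  \int[lebesgue k]_z (`|v z / c - 1| * gpdf 1 (z - x))%:E.

Let mosc : measurable_fun setT (fun z : 'cV[R]_k => `|v z / c - 1|%R).
Proof.
by apply: measurableT_comp => //; apply: measurable_funB => //; exact: measurable_funM.
Qed.

(* With f = v phi(. - x) / c, g = phi(. - x) and kappa the posterior mass of B,
   f(B) = kappa f(R^k); since |f - g| has mass osc, both |f(B) - g(B)| and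
   |f(R^k) - 1| are at most osc. *)
Lemma posterior_tv_bound y : joint_mass (s *: D) v s G setT y < +oo ->
  (forall B, measurable B -> joint_mass (s *: D) v s G B y =
     K y B * joint_mass (s *: D) v s G setT y) ->
  tv_dist (K y) (gaussian (G *m ((D *m D^T) *m y))
    (s ^+ 2 *: (G *m (D *m D^T) *m G^T))) <= 2%:E * prior_oscillation (center y).
Proof.
move=> joo jE; apply: ge_ereal_sup => _ [B mB <-].
set x := center y; pose A := G *m (s *: D).
have -> : G *m ((D *m D^T) *m y) = A *m x.
  rewrite /A /x /center -!scalemxAr -scalemxAl scalerA mulVf ?gt_eqF//.
  by rewrite scale1r !mulmxA.
have -> : (s ^+ 2 *: (G *m (D *m D^T) *m G^T))%R = A *m A^T.
  have AT : A^T = (s *: (D^T *m G^T))%R by rewrite /A -scalemxAr linearZ/= trmx_mul.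
  rewrite AT /A -!scalemxAr -scalemxAl scalerA -expr2.
  by rewrite !mulmxA.
rewrite affine_gaussian_law//.
set NB := \int[lebesgue k]_z _.
have [C C0 CE] := gpdf_isometry y DD s0.
pose dens z := (v z / c * gpdf 1 (z - x))%R.
have dens0 z : (0 <= dens z)%R by rewrite mulr_ge0 ?gpdf_ge0// divr_ge0// ltW.
have mgx : measurable_fun setT (fun z : 'cV[R]_k => gpdf 1 (z - x)).
  exact: (measurableT_comp (@measurable_gpdf R k _) (measurable_addmx _)).
have mdens : measurable_fun setT dens.
  by apply: measurable_funM => //; exact: measurable_funM.
have mAB B' : measurable B' -> measurable_fun setT (fun z : 'cV[R]_k => \1_B' (A *m z) : R).
  move=> mB'; exact: (measurableT_comp (measurable_indic mB') (measurable_mulmx A)).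
pose f B' := \int[lebesgue k]_z (\1_B' (A *m z) * dens z)%:E.
pose g B' := \int[lebesgue k]_z (\1_B' (A *m z) * gpdf 1 (z - x))%:E.
have f0 B' : 0 <= f B'.
  by apply: integral_ge0 => z _; rewrite lee_fin mulr_ge0// indicE.
have g0 B' : 0 <= g B'.
  by apply: integral_ge0 => z _; rewrite lee_fin mulr_ge0 ?gpdf_ge0// indicE.
have jf B' : measurable B' ->
    joint_mass (s *: D) v s G B' y = (C * c)%:E * f B'.
  move=> mB'; rewrite /f -ge0_integralZl//; last 3 first.
  - by apply/measurable_EFinP; apply: measurable_funM => //; exact: mAB.
  - by move=> z _; rewrite lee_fin mulr_ge0// indicE.
  - by rewrite lee_fin mulr_ge0// ltW.
  apply: eq_integral => z _; rewrite -EFinM /A mulmxA CE /dens -/x; congr EFin.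
  by field; rewrite gt_eqF.
have Cc0 : (0 < C * c)%R by rewrite mulr_gt0.
have fT : f setT < +oo.
  have := joo; rewrite jf//; have := f0 setT.
  by case: (f setT) => [r||]//= _; rewrite ?ltry// gt0_muley ?lte_fin.
have fE : f B = K y B * f setT.
  have := jE B mB; rewrite !jf// muleCA => /(congr1 (fun t => (C * c)^-1%:E * t)).
  by rewrite !muleA -!EFinM mulVf ?gt_eqF// !mul1e.
have gT : g setT = 1.
  apply: (etrans _ (integral_gpdf x (@ltr01 R))); apply: eq_integral => z _.
  by rewrite indicE in_setT mul1r.
have -> : NB = g B by [].
set osc := prior_oscillation x.
have osc0 : 0 <= osc.
  by apply: integral_ge0 => z _; rewrite lee_fin mulr_ge0 ?gpdf_ge0.
have mo : measurable_fun setT (fun z : 'cV[R]_k => (`|v z / c - 1| * gpdf 1 (z - x))%:E).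
  by apply/measurable_EFinP; exact: measurable_funM.
have mfB B' : measurable B' ->
    measurable_fun setT (fun z : 'cV[R]_k => (\1_B' (A *m z) * dens z)%:E).
  by move=> mB'; apply/measurable_EFinP; apply: measurable_funM => //; exact: mAB.
have mgB B' : measurable B' ->
    measurable_fun setT (fun z : 'cV[R]_k => (\1_B' (A *m z) * gpdf 1 (z - x))%:E).
  by move=> mB'; apply/measurable_EFinP; apply: measurable_funM => //; exact: mAB.
have ind01 (B' : set 'cV[R]_p) (z : 'cV[R]_k) : (0 <= (\1_B' (A *m z) : R) <= 1)%R by rewrite indicE ler0n lern1 leq_b1.
have fg B' : measurable B' -> f B' <= g B' + osc.
  move=> mB'; rewrite -ge0_integralD//; last 3 first.
  - by move=> z _; rewrite lee_fin mulr_ge0 ?gpdf_ge0//; case/andP: (ind01 B' z).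
  - exact: mgB.
  - by move=> z _; rewrite lee_fin mulr_ge0 ?gpdf_ge0.
  apply: ge0_le_integral => //.
  - by move=> z _; rewrite lee_fin mulr_ge0//; case/andP: (ind01 B' z).
  - exact: mfB.
  - by apply: emeasurable_funD => //; exact: mgB.
  - move=> z _; rewrite -EFinD lee_fin /dens (mulrA (\1_B' _) (v z / c)%R) -mulrDl.
    rewrite ler_wpM2r ?gpdf_ge0//; have := ind01 B' z.
    move: (\1_B' (A *m z) : R) (v z / c)%R => i t /andP[i0 i1].
    have : (i * (t - 1) <= i * `|t - 1|)%R by rewrite ler_wpM2l// ler_norm.
    have : (i * `|t - 1| <= `|t - 1|)%R by rewrite ler_piMl.
    lra.
have gf B' : measurable B' -> g B' <= f B' + osc.
  move=> mB'; rewrite -ge0_integralD//; last 3 first.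
  - by move=> z _; rewrite lee_fin mulr_ge0//; case/andP: (ind01 B' z).
  - exact: mfB.
  - by move=> z _; rewrite lee_fin mulr_ge0 ?gpdf_ge0.
  apply: ge0_le_integral => //.
  - by move=> z _; rewrite lee_fin mulr_ge0 ?gpdf_ge0//; case/andP: (ind01 B' z).
  - exact: mgB.
  - by apply: emeasurable_funD => //; exact: mfB.
  - move=> z _; rewrite -EFinD lee_fin /dens (mulrA (\1_B' _) (v z / c)%R) -mulrDl.
    rewrite ler_wpM2r ?gpdf_ge0//; have := ind01 B' z.
    move: (\1_B' (A *m z) : R) (v z / c)%R => i t /andP[i0 i1].
    have : (i * (- (t - 1)) <= i * `|t - 1|)%R.
      by rewrite ler_wpM2l// -normrN ler_norm.
    have : (i * `|t - 1| <= `|t - 1|)%R by rewrite ler_piMl.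
    lra.
have := fg _ mB; have := gf _ mB; have := fg _ measurableT; have := gf _ measurableT.
have K1 : K y B <= 1.
  rewrite -(prob_kernel (s := K) y); apply: le_measure; rewrite ?inE//.
have K0 : 0 <= K y B by [].
rewrite fE gT; move: K0 K1 fT (f0 setT) (g0 B) osc0.
have gB1 : g B <= 1.
  rewrite -gT; apply: ge0_le_integral => //.
  - by move=> z _; rewrite lee_fin mulr_ge0 ?gpdf_ge0//; case/andP: (ind01 B z).
  - exact: mgB.
  - exact: mgB.
  - move=> z _; rewrite lee_fin ler_wpM2r ?gpdf_ge0//.
    by rewrite [X in (_ <= X)%R]indicE in_setT; case/andP: (ind01 B z).
move: gB1; clear fg gf; clearbody osc.
case: (K y B) => [kappa||]//; case: (f setT) => [ft||]//; case: (g B) => [gb||]//.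
case: osc => [e||]//; last first.
  by move=> *; rewrite gt0_muley ?lte_fin// leey.
rewrite -!EFinM -!EFinD /= !lee_fin => g1 k0 k1 _ ft0 gb0 e0 h1 h2 h3 h4.
rewrite ler_norml.
(* In kappa - gb = kappa (1 - ft) + (kappa ft - gb) each summand is at most [e] in absolute value,
   as 0 <= kappa <= 1. *)
have : (kappa * e <= e)%R by rewrite ler_piMl.
have : (kappa * (ft - 1 - e) <= 0)%R by rewrite mulr_ge0_le0//; lra.
have : (kappa * (1 - ft - e) <= 0)%R by rewrite mulr_ge0_le0//; lra.
by move=> *; apply/andP; split; lra.
Qed.

Lemma measurable_prior_oscillation : measurable_fun setT prior_oscillation.
Proof.
have m2 : measurable_fun setT (fun xz : 'cV[R]_k * 'cV[R]_k =>
    (`|v xz.2 / c - 1| * gpdf 1 (xz.2 - xz.1))%:E).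
  apply/measurable_EFinP; apply: measurable_funM.
    exact: (measurableT_comp mosc (@measurable_snd _ _ _ _)).
  exact: (measurableT_comp (@measurable_gpdf R k _) (@measurable_subr2 R k)).
apply: (@measurable_fun_fubini_tonelli_F _ _ _ _ _ (lebesgue k) _ m2) => z.
by rewrite lee_fin mulr_ge0 ?gpdf_ge0.
Qed.

Let mcenter : measurable_fun setT center.
Proof.
rewrite (_ : center = mulmx (s^-1 *: D^T)); first exact: measurable_mulmx.
by apply/funext => y; rewrite /center -scalemxAl.
Qed.

Lemma integral_gaussian_center (F : 'cV[R]_n) (h : 'cV[R]_k -> \bar R) :
  measurable_fun setT h -> (forall x, 0 <= h x) ->
  \int[gaussian F (s ^+ 2)%:M]_y h (center y) =
  \int[lebesgue k]_u (h u * (gpdf 1 (u - center F))%:E).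
Proof.
move=> mh h0.
pose m := image_measure
  (gaussian F (s ^+ 2)%:M) mcenter.
transitivity (\int[m]_u h u).
  by rewrite (ge0_integral_pushforward mcenter (gaussian F _) measurableT mh).
apply: (@ge0_integral_density _ _ _ (lebesgue k) m
  (fun u => gpdf 1 (u - center F)%R)) => //.
- exact: (measurableT_comp (@measurable_gpdf R k _) (measurable_addmx _)).
- by move=> u; exact: gpdf_ge0.
move=> A mA; rewrite /m /= /pushforward.
have -> : (s ^+ 2)%:M = s%:M *m (s%:M)^T :> 'M[R]_n.
  by rewrite tr_scalar_mx -scalar_mxM expr2.
rewrite gaussianE; last exact: (measurable_preimage mcenter mA).
have := @gaussian_scalarE R k 1 (center F) A ltr01 mA.
rewrite expr1n => <-.
(* The identity covariance is written as D^T (D^T)^T, so that both sides are images of the same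
   standard normal vector in R^n. *)
rewrite -DD -[X in gaussian _ (_ *m X)](trmxK D) gaussianE//.
congr (std_normal n _); apply/funext => z /=.
rewrite /affine /center mulmxDr scalerDr mul_scalar_mx -scalemxAr scalerA.
by rewrite mulVf ?gt_eqF// scale1r.
Qed.

(** The sampling noise of the centre and the posterior noise around it are convolved: variance 1 + 1
    = 2. *)
Lemma integral_prior_oscillation (x0 : 'cV[R]_k) :
  \int[lebesgue k]_u (prior_oscillation u * (gpdf 1 (u - x0))%:E) =
  \int[lebesgue k]_z (`|v z / c - 1| * gpdf 2 (z - x0))%:E.
Proof.
pose o z := `|v z / c - 1|%R.
have m3 : measurable_fun setT (fun uz : 'cV[R]_k * 'cV[R]_k =>
    (o uz.2)%:E * (gpdf 1 (uz.2 - uz.1) * gpdf 1 (uz.1 - x0))%:E).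
  apply: emeasurable_funM; apply/measurable_EFinP.
    exact: (measurableT_comp mosc (@measurable_snd _ _ _ _)).
  apply: measurable_funM.
    exact: (measurableT_comp (@measurable_gpdf R k _) (@measurable_subr2 R k)).
  exact: (measurableT_comp (measurableT_comp (@measurable_gpdf R k _)
    (measurable_addmx _)) (@measurable_fst _ _ _ _)).
have g0 u z : (0 <= gpdf 1 (z - u) * gpdf 1 (u - x0) :> R)%R.
  by rewrite mulr_ge0 ?gpdf_ge0.
transitivity (\int[lebesgue k]_u \int[lebesgue k]_z
    ((o z)%:E * (gpdf 1 (z - u) * gpdf 1 (u - x0))%:E)).
  apply: eq_integral => u _; rewrite /prior_oscillation -ge0_integralZr//.
  - by apply: eq_integral => z _; rewrite -!EFinM; congr EFin; exact/esym/mulrA.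
  - apply/measurable_EFinP; apply: measurable_funM => //.
    exact: (measurableT_comp (@measurable_gpdf R k _) (measurable_addmx _)).
  - by move=> z _; rewrite lee_fin mulr_ge0 ?gpdf_ge0.
  - by rewrite lee_fin gpdf_ge0.
rewrite (@fubini_tonelli _ _ _ _ _ (lebesgue k) (lebesgue k) _ m3); last first.
  by move=> uz /=; rewrite -EFinM lee_fin; apply: mulr_ge0; [exact: normr_ge0|exact: g0].
apply: eq_integral => z _ /=.
have mz : measurable_fun setT (fun u : 'cV[R]_k => (gpdf 1 (z - u) * gpdf 1 (u - x0))%:E).
  apply/measurable_EFinP; apply: measurable_funM.
    exact: (measurableT_comp (measurableT_comp (@measurable_gpdf R k _)
      (@measurable_subr2 R k)) (pair2_measurable z)).
  exact: (measurableT_comp (@measurable_gpdf R k _) (measurable_addmx _)).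
rewrite ge0_integralZl//; last 2 first.
- by move=> u _; rewrite lee_fin.
- by rewrite lee_fin; exact: normr_ge0.
rewrite (integral_lebesgue_translate x0)//; last by move=> u; rewrite lee_fin.
transitivity ((o z)%:E * \int[lebesgue k]_u (gpdf 1 (z - x0 - u) * gpdf 1 u)%:E).
  congr (_ * _); apply: eq_integral => u _; rewrite addrK.
  by congr (gpdf 1 _ * _)%:E; rewrite opprD addrA addrAC.
by rewrite gpdf_convolution.
Qed.

Lemma integral_posterior_tv_le (F0 : 'cV[R]_n) :
  \int[gaussian F0 (s ^+ 2)%:M]_y
     tv_dist (K y) (gaussian (G *m ((D *m D^T) *m y))
       (s ^+ 2 *: (G *m (D *m D^T) *m G^T)))
  <= 2%:E * \int[lebesgue k]_z (`|v z / c - 1| * gpdf 2 (z - center F0))%:E.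
Proof.
have [N [mN N0 goodN]] := posterior_ae mv v0 WE s0 posteriorK.
have osc0 x : 0 <= prior_oscillation x.
  by apply: integral_ge0 => z _; rewrite lee_fin mulr_ge0 ?gpdf_ge0.
(* The infinite term makes the bound hold at every [y], also on the exceptional set; it integrates
   to 0 because the law of Y has a density. *)
pose T y := 2%:E * prior_oscillation (center y) + +oo * (\1_N y)%:E.
have mosc' : measurable_fun setT (fun y => prior_oscillation (center y)).
  exact: (measurableT_comp measurable_prior_oscillation mcenter).
have mN1 : measurable_fun setT (fun y : 'cV[R]_n => (\1_N y)%:E : \bar R).
  by apply/measurable_EFinP; exact: measurable_indic.
apply: (@le_trans _ _ (\int[gaussian F0 (s ^+ 2)%:M]_y T y)).
  apply: ge0_le_integral_nonmeasurable => y.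
    apply: le_ereal_sup_tmp; exists 0 => //; exists set0 => //.
    by rewrite !measure0 sube0 abse0.
  rewrite /T; have [yN|yN] := pselect (N y).
    rewrite indicE mem_set// mule1 addey ?leey//.
    by rewrite gt_eqF // (lt_le_trans ltNy0) // mule_ge0.
  have [joo jE] : joint_mass (s *: D) v s G setT y < +oo /\
    forall B, measurable B -> joint_mass (s *: D) v s G B y =
      K y B * joint_mass (s *: D) v s G setT y.
    by apply: contrapT => bad; apply: yN; exact: goodN.
  rewrite indicE memNset// mule0 adde0; exact: posterior_tv_bound.
have gN0 : gaussian F0 (s ^+ 2)%:M N = 0.
  rewrite gaussian_scalarE//; apply: null_set_integral => //.
  apply/measurable_funTS/measurable_EFinP.
  exact: (measurableT_comp (@measurable_gpdf R n _) (measurable_addmx _)).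
rewrite /T ge0_integralD//; last 3 first.
- by move=> y _; rewrite mule_ge0.
- exact: measurable_funeM.
- exact: measurable_funeM.
rewrite ge0_integralZl// [X in _ + X]ge0_integralZl//.
have gN1 : \int[gaussian F0 (s ^+ 2)%:M]_y (\1_N y)%:E = 0.
  by rewrite integral_indic// setIT.
rewrite gN1 mule0 adde0.
rewrite (integral_gaussian_center F0 measurable_prior_oscillation osc0).
by rewrite integral_prior_oscillation.
Qed.

End posterior_tv.
End key_inequality.

(** * The two families of priors *)

Section design.
Context {R : realType} {n k : nat}.
Variable Phi : 'M[R]_(n, k).
Hypothesis rank_Phi : \rank Phi = k.

Lemma gram_unit : Phi^T *m Phi \in unitmx.
Proof.
have free : row_free Phi^T by rewrite /row_free mxrank_tr rank_Phi.
rewrite -row_free_unit -kermx_eq0; set N := kermx _.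
have NP : N *m Phi^T = 0.
  apply/row_matrixP => i; rewrite row0; apply: gram_eq0.
  rewrite row_mul trmx_mul trmxK mulmxA -(mulmxA (row i N)) -row_mul.
  by rewrite mulmx_ker row0 mul0mx mxE.
by move/eqP: NP; rewrite mulmx_free_eq0.
Qed.

(** Any square root [L] of the Gram matrix turns the regressors into an orthonormal basis [D] of
    their span. The equation for [L] is kept because |det L| enters the Jacobian from theta to z. *)
Lemma design_isometry : exists2 L : 'M[R]_k, L \in unitmx &
  let D := Phi *m (invmx L)^T in
  [/\ D^T *m D = 1%:M, D *m D^T = hat Phi, L *m L^T = Phi^T *m Phi &
      forall F, (invmx L)^T *m (D^T *m F) = lse Phi F].
Proof.
have [L] := gram_square_root (Phi^T); rewrite trmxK => LL.
have uL : L \in unitmx by have := gram_unit; rewrite -LL unitmx_mul => /andP[].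
have uLT : L^T \in unitmx by rewrite unitmx_tr.
have LLi : (invmx L)^T *m invmx L = invmx (Phi^T *m Phi).
  rewrite -[LHS](mulmxK gram_unit) -[in X in X *m _]LL mulmxA mulmxKV//.
  by rewrite -trmx_mul mulmxV// trmx1 mul1mx.
exists L => //= ; split => //.
- rewrite trmx_mul trmxK mulmxA -(mulmxA (invmx L)) -LL mulmxA mulVmx// mul1mx.
  by rewrite trmx_inv mulmxV.
- by rewrite trmx_mul trmxK mulmxA -(mulmxA Phi) LLi.
- by move=> F; rewrite trmx_mul trmxK !mulmxA LLi.
Qed.

End design.

(** * Gaussian moments and the oscillation of a Gaussian prior *)

Section oscillation_bounds.
Context {R : realType}.

Lemma sqnN n (x : 'cV[R]_n) : sqn (- x) = sqn x.
Proof. by apply: eq_bigr => i _; rewrite mxE sqrrN. Qed.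

Lemma sqn_isometry_le n k (D : 'M[R]_(n, k)) y :
  D^T *m D = 1%:M -> sqn (D^T *m y) <= sqn y.
Proof.
move=> DD; have := isometry_sqn y 0 DD.
rewrite mulmx0 subr0 sub0r sqnN => ->.
by rewrite lerDr sqn_ge0.
Qed.

(* E exp (- a |x + sqrt 2 Z|^2) for a standard normal Z in R^k. *)
Definition gauss_mgf k (a : R) (x : 'cV[R]_k) : R :=
  (Num.sqrt (1 + 4 * a))^-1 ^+ k * expR (- (a / (1 + 4 * a) * sqn x)).

Lemma gauss_mgf_gt0 k a (x : 'cV[R]_k) : 0 <= a -> 0 < gauss_mgf a x.
Proof.
move=> a0; rewrite mulr_gt0 ?expR_gt0// exprn_gt0// invr_gt0 sqrtr_gt0; lra.
Qed.

Lemma integral_gauss_mgf k (a : R) (x : 'cV[R]_k) : 0 <= a ->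
  (\int[lebesgue k]_z (expR (- (a * sqn z)) * gpdf 2 (z - x))%:E =
   (gauss_mgf a x)%:E)%E.
Proof.
move=> a0; have a1 : 0 < 1 + 4 * a by lra.
(* Completing the square: what remains is the density of N(x / (1 + 4 a), 2 / (1 + 4 a) I). *)
transitivity (\int[lebesgue k]_z ((gauss_mgf a x)%:E *
  (gpdf (2 / (1 + 4 * a)) (z - (1 + 4 * a)^-1 *: x))%:E))%E.
  apply: eq_integral => z _; rewrite -EFinM; congr EFin.
  rewrite /gpdf /gauss_mgf mulrCA [in RHS]mulrACA -exprMn -invfM -!expRD.
  rewrite -sqrtrM; last by rewrite ltW.
  congr ((Num.sqrt _)^-1 ^+ _ * expR _); first by field; rewrite gt_eqF.
  rewrite /sqn !mulr_sumr !mulr_suml -!sumrN -!big_split/=; apply: eq_bigr => i _.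
  by rewrite !mxE; field; rewrite gt_eqF.
rewrite ge0_integralZl ?integral_gpdf ?mule1//.
- by rewrite divr_gt0.
- by apply/measurable_EFinP; exact: (measurableT_comp (@measurable_gpdf R k _)
    (measurable_addmx _)).
- by move=> z _; rewrite lee_fin gpdf_ge0.
- by rewrite lee_fin ltW// gauss_mgf_gt0.
Qed.

(** Each coordinate contributes the square root of (1 + 2 b)^2 / (1 + 4 b) <= 1 + 4 b^2 <= exp(4
    b^2), and the coefficient of |x|^2 is b / (1 + 2 b) - b / (1 + 4 b) <= 2 b^2: the first order in
    [b] cancels in both. *)
Lemma gauss_mgf_ratio k (b : R) (x : 'cV[R]_k) : 0 <= b ->
  gauss_mgf b x / gauss_mgf (b / 2) x ^+ 2 <=
  expR (2 * (k%:R * b ^+ 2) + 2 * (b ^+ 2 * sqn x)).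
Proof.
move=> b0.
have b1 : 0 < 1 + 4 * b by lra.
have b2 : 0 < 1 + 2 * b by lra.
have -> : gauss_mgf b x / gauss_mgf (b / 2) x ^+ 2 =
   ((1 + 2 * b) / Num.sqrt (1 + 4 * b)) ^+ k *
   expR ((b / (1 + 2 * b) - b / (1 + 4 * b)) * sqn x).
  rewrite /gauss_mgf (_ : 1 + 4 * (b / 2) = 1 + 2 * b); last by field.
  rewrite exprMn invfM mulrACA; congr (_ * _).
    rewrite -exprM mulnC exprM !exprVn sqr_sqrtr; last exact: ltW.
    by rewrite invrK expr_div_n mulrC.
  rewrite -expRM_natl -expRB; congr expR; field.
  by rewrite !gt_eqF.
rewrite expRD; apply: ler_pM; rewrite ?expR_ge0//.
- by rewrite exprn_ge0// divr_ge0 ?sqrtr_ge0// ltW.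
- rewrite mulrCA expRM_natl lerXn2r ?nnegrE ?expR_ge0//.
    by rewrite divr_ge0 ?sqrtr_ge0// ltW.
  rewrite ler_pdivrMr ?sqrtr_gt0// -ler_sqr ?nnegrE; last 2 first.
  - exact: ltW.
  - by rewrite mulr_ge0 ?expR_ge0 ?sqrtr_ge0.
  rewrite exprMn sqr_sqrtr; last exact: ltW.
  rewrite -expRM_natl; have := expR_ge1Dx (2 * (2 * b ^+ 2)).
  rewrite -(ler_pM2r b1); apply: le_trans.
  rewrite -subr_ge0 (_ : _ - _ = 16 * b ^+ 3); last by ring.
  by rewrite mulr_ge0// exprn_ge0.
- rewrite ler_expR mulrA ler_wpM2r ?sqn_ge0//.
  rewrite (_ : _ - _ = 2 * b ^+ 2 / ((1 + 2 * b) * (1 + 4 * b))); last first.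
    by field; rewrite !gt_eqF.
  rewrite ler_pdivrMr ?mulr_gt0// ler_peMr ?mulr_ge0 ?sqr_ge0//.
  by rewrite mulr_ege1//; lra.
Qed.

(** Dividing by the mean makes the variable u have mean 1, so E (u - 1)^2 is the ratio of moments
    minus 1; [d] is left free to balance the two terms. *)
Lemma gauss_prior_oscillation k (b d : R) (x : 'cV[R]_k) : 0 <= b -> 0 < d ->
  (\int[lebesgue k]_z (`|expR (- (b / 2 * sqn z)) / gauss_mgf (b / 2) x - 1| *
      gpdf 2 (z - x))%:E <=
   (d + (gauss_mgf b x / gauss_mgf (b / 2) x ^+ 2 - 1) / d)%:E)%E.
Proof.
move=> b0 d0; set m1 := gauss_mgf (b / 2) x; set m2 := gauss_mgf b x.
have b20 : 0 <= b / 2 by rewrite divr_ge0.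
have m10 : 0 < m1 by exact: gauss_mgf_gt0.
have m20 : 0 < m2 by exact: gauss_mgf_gt0.
pose t (z : 'cV[R]_k) := expR (- (b / 2 * sqn z)) / m1.
have mg : measurable_fun setT (fun z : 'cV[R]_k => gpdf 2 (z - x)).
  exact: (measurableT_comp (@measurable_gpdf R k _) (measurable_addmx _)).
have mE a : measurable_fun setT (fun z : 'cV[R]_k => expR (- (a * sqn z))).
  have := @measurable_expR_sqn R k (- a) 0.
  by apply: eq_measurable_fun => z _; rewrite addr0 mulNr.
have mt : measurable_fun setT t by apply: measurable_funM.
have t0 z : 0 <= t z by rewrite divr_ge0 ?expR_ge0// ltW.
set I := (X in (X <= _)%E).
have mEg a : measurable_fun setT (fun z : 'cV[R]_k =>
  expR (- (a * sqn z)) * gpdf 2 (z - x)) by exact: measurable_funM.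
have Eg0 a (z : 'cV[R]_k) : 0 <= expR (- (a * sqn z)) * gpdf 2 (z - x).
  by rewrite mulr_ge0 ?expR_ge0 ?gpdf_ge0.
have cE : (2 / d)%:E = (\int[lebesgue k]_z
   (2 / d / m1 * (expR (- (b / 2 * sqn z)) * gpdf 2 (z - x)))%:E)%E.
  rewrite (@integral_EFinZl _ _ _ _ _ m1)//; [|by rewrite !divr_ge0// ltW|exact: integral_gauss_mgf].
  by rewrite divfK// gt_eqF.
have J1 : (\int[lebesgue k]_z ((d + d^-1) * gpdf 2 (z - x))%:E = (d + d^-1)%:E)%E.
  rewrite (@integral_EFinZl _ _ _ _ _ 1) ?mulr1//; first by rewrite addr_ge0 ?invr_ge0 ?ltW.
    by move=> z; exact: gpdf_ge0.
  exact: integral_gpdf.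
have J2 : (\int[lebesgue k]_z
   ((d * m1 ^+ 2)^-1 * (expR (- (b * sqn z)) * gpdf 2 (z - x)))%:E =
   ((d * m1 ^+ 2)^-1 * m2)%:E)%E.
  apply: integral_EFinZl => //; last exact: integral_gauss_mgf.
  by rewrite invr_ge0 mulr_ge0 ?exprn_ge0// ltW.
have mf1 : measurable_fun setT (fun z : 'cV[R]_k =>
    (`|expR (- (b / 2 * sqn z)) / m1 - 1| * gpdf 2 (z - x))%:E).
  apply/measurable_EFinP; apply: measurable_funM => //.
  by apply: measurableT_comp => //; apply: measurable_funB.
have mf2 : measurable_fun setT (fun z : 'cV[R]_k =>
    (2 / d / m1 * (expR (- (b / 2 * sqn z)) * gpdf 2 (z - x)))%:E).
  by apply/measurable_EFinP; exact: measurable_funM.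
have mf3 : measurable_fun setT (fun z : 'cV[R]_k => ((d + d^-1) * gpdf 2 (z - x))%:E).
  by apply/measurable_EFinP; exact: measurable_funM.
have mf4 : measurable_fun setT (fun z : 'cV[R]_k =>
    ((d * m1 ^+ 2)^-1 * (expR (- (b * sqn z)) * gpdf 2 (z - x)))%:E).
  by apply/measurable_EFinP; exact: measurable_funM.
have f10 (z : 'cV[R]_k) :
    (0 <= (`|expR (- (b / 2 * sqn z)) / m1 - 1| * gpdf 2 (z - x))%:E)%E.
  by rewrite lee_fin mulr_ge0 ?gpdf_ge0.
have f20 z : (0 <= (2 / d / m1 * (expR (- (b / 2 * sqn z)) * gpdf 2 (z - x)))%:E)%E.
  by rewrite lee_fin mulr_ge0// !divr_ge0// ltW.
have f30 (z : 'cV[R]_k) : (0 <= ((d + d^-1) * gpdf 2 (z - x))%:E)%E.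
  by rewrite lee_fin mulr_ge0 ?gpdf_ge0// addr_ge0 ?invr_ge0 ?ltW.
have f40 z : (0 <= ((d * m1 ^+ 2)^-1 * (expR (- (b * sqn z)) * gpdf 2 (z - x)))%:E)%E.
  by rewrite lee_fin mulr_ge0// invr_ge0 mulr_ge0 ?exprn_ge0// ltW.
have : (I + (2 / d)%:E <= (d + d^-1)%:E + ((d * m1 ^+ 2)^-1 * m2)%:E)%E.
  rewrite -J1 -J2 {1}cE /I -!ge0_integralD//.
  apply: ge0_le_integral => //.
  - by move=> z _; rewrite adde_ge0.
  - exact: emeasurable_funD.
  - exact: emeasurable_funD.
  (* |u - 1| <= d + (u - 1)^2 / d, with the linear term moved to the left *)
  - move=> z _; rewrite -!EFinD lee_fin.
    have -> : expR (- (b * sqn z)) = m1 ^+ 2 * t z ^+ 2.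
      rewrite /t expr_div_n mulrCA divff ?mulr1 ?expf_neq0 ?gt_eqF//.
      by rewrite -expRM_natl; congr expR; field.
    have -> : expR (- (b / 2 * sqn z)) = m1 * t z.
      by rewrite /t mulrCA divff ?mulr1// gt_eqF.
    have := gpdf_ge0 2 (z - x); move: (gpdf 2 (z - x)) (t z) => g u g0.
    rewrite (_ : m1 * u / m1 = u); last by field; rewrite gt_eqF.
    rewrite (_ : `|u - 1| * g + 2 / d / m1 * (m1 * u * g) =
      (`|u - 1| + 2 / d * u) * g); last by field; rewrite !gt_eqF.
    rewrite (_ : (d + d^-1) * g + (d * m1 ^+ 2)^-1 * (m1 ^+ 2 * u ^+ 2 * g) =
      (d + (u ^+ 2 + 1) / d) * g); last by field; rewrite !gt_eqF.
    rewrite ler_wpM2r// -subr_ge0.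
    rewrite (_ : _ - _ = ((d - `|u - 1|) ^+ 2 + d * `|u - 1|) / d).
      by rewrite divr_ge0 ?addr_ge0 ?sqr_ge0 ?mulr_ge0// ltW.
    rewrite sqrrB real_normK ?num_real//; field; exact: lt0r_neq0.
rewrite -leeBrDr// => /le_trans; apply.
rewrite -!EFinD -?EFinB lee_fin.
rewrite (_ : d + d^-1 + _ - _ = d + (m2 / m1 ^+ 2 - 1) / d)//.
by field; rewrite !gt_eqF.
Qed.

End oscillation_bounds.

(** * Risk bounds at fixed n under (A) and (B) *)

Section finite_sample_bounds.
Context {R : realType}.

Lemma gpdf2_le_expR k (M : R) (u : 'cV[R]_k) :
  M <= sqn u -> gpdf 2 u <= expR (- (M / 4)).
Proof.
move=> Mu; rewrite /gpdf -[leRHS]mul1r ler_pM ?expR_ge0 ?exprn_ge0 ?invr_ge0 ?sqrtr_ge0//.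
- rewrite exprn_ile1 ?invr_ge0 ?sqrtr_ge0// invf_le1.
    rewrite -[leLHS]sqrtr1 ler_sqrt; have := @pi_ge2 R; lra.
  rewrite sqrtr_gt0; have := @pi_ge2 R; lra.
- rewrite ler_expR lerN2; lra.
Qed.

(** Half of the exponent pays for exp(- M / 8); the other half is the N(0, 4 I) density, whose peak
    is smaller by sqrt 2 ^ k. Its integral being 1, this bounds the Gaussian tail. *)
Lemma gpdf2_le_gpdf4 k (M : R) (u : 'cV[R]_k) : M <= sqn u ->
  gpdf 2 u <= Num.sqrt 2 ^+ k * expR (- (M / 8)) * gpdf 4 u.
Proof.
move=> Mu.
have -> : gpdf 2 u = Num.sqrt 2 ^+ k * expR (- (sqn u / 8)) * gpdf 4 u.
  have pi0 := @pi_ge2 R.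
  rewrite /gpdf mulrACA -exprMn -expRD; congr (_ ^+ _ * expR _); last by field.
  have -> : Num.sqrt (4 * (pi *+ 2)) = Num.sqrt 2 * Num.sqrt (2 * (pi *+ 2)) :> R.
    by rewrite -sqrtrM//; congr Num.sqrt; ring.
  by rewrite invfM mulVKf// gt_eqF// sqrtr_gt0.
rewrite ler_wpM2r ?gpdf_ge0// ler_wpM2l ?exprn_ge0 ?sqrtr_ge0// ler_expR; lra.
Qed.

(** Outside the ball |v / c - 1| <= v / c + 1: for the first summand the Gaussian density is bounded
    uniformly and [v] has mass 1, for the second the Gaussian tail is used. *)
Lemma local_prior_oscillation k (v : 'cV[R]_k -> R) (x : 'cV[R]_k) (c d M : R) :
  measurable_fun setT v -> (forall z, 0 <= v z) ->
  (\int[lebesgue k]_z (v z)%:E = 1)%E -> 0 < c -> 0 <= d ->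
  (forall z, sqn (z - x) <= M -> `|v z / c - 1| <= d) ->
  (\int[lebesgue k]_z (`|v z / c - 1| * gpdf 2 (z - x))%:E <=
   (d + c^-1 * expR (- (M / 4)) + Num.sqrt 2 ^+ k * expR (- (M / 8)))%:E)%E.
Proof.
move=> mv v0 v1 c0 d0 dE.
have mg t : measurable_fun setT (fun z : 'cV[R]_k => gpdf t (z - x)).
  exact: (measurableT_comp (@measurable_gpdf R k _) (measurable_addmx _)).
have iZ (a : R) (f : 'cV[R]_k -> R) : 0 <= a -> measurable_fun setT f ->
    (forall z, 0 <= f z) -> (\int[lebesgue k]_z (f z)%:E = 1)%E ->
    (\int[lebesgue k]_z (a * f z)%:E = a%:E)%E.
  by move=> a0 mf f0 fE; rewrite (integral_EFinZl a0 mf f0 fE) mulr1.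
set a2 := c^-1 * _; set a3 := Num.sqrt 2 ^+ k * _.
have a20 : 0 <= a2 by rewrite mulr_ge0 ?expR_ge0 ?invr_ge0 ?ltW.
have a30 : 0 <= a3 by rewrite mulr_ge0 ?expR_ge0 ?exprn_ge0 ?sqrtr_ge0.
have g0 t (z : 'cV[R]_k) : 0 <= gpdf t (z - x) by exact: gpdf_ge0.
rewrite !EFinD -(iZ d (fun z => gpdf 2 (z - x)))//; last exact: integral_gpdf.
rewrite -(iZ a2 v)// -(iZ a3 (fun z => gpdf 4 (z - x)))//; last exact: integral_gpdf.
have mf1 : measurable_fun setT (fun z : 'cV[R]_k => (d * gpdf 2 (z - x))%:E).
  by apply/measurable_EFinP; exact: measurable_funM.
have mf2 : measurable_fun setT (fun z => (a2 * v z)%:E).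
  by apply/measurable_EFinP; exact: measurable_funM.
have mf3 : measurable_fun setT (fun z : 'cV[R]_k => (a3 * gpdf 4 (z - x))%:E).
  by apply/measurable_EFinP; exact: measurable_funM.
have f10 (z : 'cV[R]_k) : (0 <= (d * gpdf 2 (z - x))%:E)%E by rewrite lee_fin mulr_ge0.
have f20 (z : 'cV[R]_k) : (0 <= (a2 * v z)%:E)%E by rewrite lee_fin mulr_ge0.
have f30 (z : 'cV[R]_k) : (0 <= (a3 * gpdf 4 (z - x))%:E)%E by rewrite lee_fin mulr_ge0.
rewrite -ge0_integralD// -ge0_integralD//; last 2 first.
- by move=> z _; rewrite adde_ge0.
- exact: emeasurable_funD.
apply: ge0_le_integral => //.
- by move=> z _; rewrite lee_fin mulr_ge0.
- apply/measurable_EFinP; apply: measurable_funM => //.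
  by apply: measurableT_comp => //; apply: measurable_funB => //; exact: measurable_funM.
- by apply: emeasurable_funD => //; exact: emeasurable_funD.
move=> z _; rewrite -!EFinD lee_fin.
have [zM|/ltW zM] := leP (sqn (z - x)) M.
  apply: (@le_trans _ _ (d * gpdf 2 (z - x))).
    by rewrite ler_wpM2r// dE.
  by rewrite -addrA lerDl addr_ge0// mulr_ge0.
apply: (@le_trans _ _ ((v z / c + 1) * gpdf 2 (z - x))).
  rewrite ler_wpM2r// (le_trans (ler_normB _ _))// normr1 ger0_norm//.
  by rewrite divr_ge0// ltW.
rewrite mulrDl mul1r -addrA ler_wpDl ?mulr_ge0// lerD//.
- rewrite (_ : a2 * v z = v z / c * expR (- (M / 4))); last first.
    by rewrite /a2 mulrC mulrA.
  by rewrite ler_wpM2l ?divr_ge0// ?gpdf2_le_expR// ltW.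
- exact: gpdf2_le_gpdf4.
Qed.

Section regression_bounds.
Variables (n k p : nat) (Phi : 'M[R]_(n, k)) (s : R) (F0 : 'cV[R]_n).
Variables (G : 'M[R]_(p, n)) (W : probability 'cV[R]_n R).
Variable K : R.-pker 'cV[R]_n ~> 'cV[R]_p.
Hypotheses (rank_Phi : \rank Phi = k) (s0 : 0 < s).
Hypothesis posteriorK : is_posterior W s G K.

Let risk : \bar R := (\int[gaussian F0 (s ^+ 2)%:M]_y
  tv_dist (K y) (gaussian (G *m (hat Phi *m y))
    (s ^+ 2 *: (G *m hat Phi *m G^T))))%E.

Lemma gaussian_prior_risk (tau d : R) : 0 < tau -> 0 < d ->
  (forall A, measurable A -> W A = gaussian 0 (tau ^+ 2 *: hat Phi) A) ->
  let y := 2 * (k%:R * (s / tau) ^+ 4) + 2 * (s / tau ^+ 2 * enorm F0) ^+ 2 in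
  (risk <= (2 * (d + (expR y - 1) / d))%:E)%E.
Proof.
move=> tau0 d0 WE /=.
have [L uL /= [DD DE LL Dlse]] := design_isometry rank_Phi.
set D := Phi *m (invmx L)^T in DD DE Dlse.
(* In the coordinate z the prior is N(0, r^2 I), and b = r^-2. *)
pose r := tau / s; pose b := (s / tau) ^+ 2.
have r0 : 0 < r by rewrite divr_gt0.
have b0 : 0 < b by rewrite exprn_gt0// divr_gt0.
pose v : 'cV[R]_k -> R := gpdf (r ^+ 2).
have WvE A : measurable A ->
    (W A = \int[lebesgue k]_(z in mulmx (s *: D) @^-1` A) (v z)%:E)%E.
  move=> mA.
  have mH : measurable (mulmx (s *: D) @^-1` A : set 'cV[R]_k).
    exact: (measurable_preimage (measurable_mulmx (s *: D)) mA).
  transitivity (gaussian 0 (r ^+ 2)%:M (mulmx (s *: D) @^-1` A)); last first.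
    rewrite (gaussian_scalarE _ r0 mH).
    by apply: eq_integral => z _; rewrite subr0.
  rewrite WE// -DE.
  have -> : tau ^+ 2 *: (D *m D^T) = (tau *: D) *m (tau *: D)^T.
    by rewrite linearZ/= -scalemxAl -scalemxAr scalerA expr2.
  have -> : (r ^+ 2)%:M = r%:M *m (r%:M)^T :> 'M[R]_k.
    by rewrite tr_scalar_mx -scalar_mxM expr2.
  rewrite !gaussianE//; congr (std_normal k _); apply/funext => z /=.
  rewrite /affine !add0r mul_scalar_mx -scalemxAr -scalemxAl -scalemxAl scalerA.
  by rewrite /r mulrVK// unitfE gt_eqF.
pose x0 : 'cV[R]_k := s^-1 *: (D^T *m F0).
pose m1 := gauss_mgf (b / 2) x0.
have m10 : 0 < m1 by rewrite gauss_mgf_gt0// divr_ge0// ltW.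
(* The peak of [v]; the choice c = [kap * m1] cancels it and leaves an exponential divided by its
   mean. *)
pose kap : R := (Num.sqrt (r ^+ 2 * (pi *+ 2)))^-1 ^+ k.
have kap0 : 0 < kap.
  by rewrite exprn_gt0// invr_gt0 sqrtr_gt0 mulr_gt0 ?exprn_gt0// mulrn_wgt0// pi_gt0.
have vE z : v z / (kap * m1) = expR (- (b / 2 * sqn z)) / m1.
  rewrite /v /gpdf -/kap invfM mulrACA divff ?gt_eqF// mul1r.
  congr (expR (- _) / _); rewrite /b /r; field.
  by rewrite !gt_eqF.
have := @integral_posterior_tv_le R n k p D v W s G K (kap * m1) DD s0
  (mulr_gt0 kap0 m10) (@measurable_gpdf R k _) (fun z => gpdf_ge0 _ z) WvE
  posteriorK F0.
rewrite DE -/risk => /le_trans; apply.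
rewrite EFinM lee_wpmul2l// -/x0.
under eq_integral do rewrite vE.
apply: le_trans (gauss_prior_oscillation x0 (ltW b0) d0) _.
rewrite lee_fin lerD2l ler_wpM2r ?invr_ge0 ?(ltW d0)// lerD2r.
apply: le_trans (gauss_mgf_ratio x0 (ltW b0)) _.
rewrite ler_expR lerD//; first by rewrite /b -exprM.
rewrite ler_wpM2l// /x0 sqnZ [leRHS]exprMn enorm_sqr.
(* D^T is a contraction, so |x0| <= |F0| / s. *)
apply: (@le_trans _ _ (b ^+ 2 * (s^-1 ^+ 2 * sqn F0))).
  by rewrite ler_wpM2l ?sqr_ge0// ler_wpM2l ?sqr_ge0//; exact: sqn_isometry_le.
rewrite mulrA ler_wpM2r ?sqn_ge0// /b.
rewrite (_ : ((s / tau) ^+ 2) ^+ 2 * s^-1 ^+ 2 = (s / tau ^+ 2) ^+ 2)//.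
by field; rewrite !gt_eqF.
Qed.

Lemma smooth_prior_risk (Wt : probability 'cV[R]_k R) (w : 'cV[R]_k -> R) (M d : R) :
  has_density Wt w ->
  (forall A, measurable A -> W A = pushforward Wt (mulmx Phi) A) ->
  0 < M -> 0 <= d -> 0 < w (lse Phi F0) ->
  (forall h, enorm (Phi *m h) ^+ 2 <= s ^+ 2 * M ->
     `|w (lse Phi F0 + h) / w (lse Phi F0) - 1| <= d) ->
  (risk <= (2 * (d + Num.sqrt (\det (Phi^T *m Phi)) / (s ^+ k * w (lse Phi F0)) *
      expR (- (M / 4)) + Num.sqrt 2 ^+ k * expR (- (M / 8))))%:E)%E.
Proof.
move=> [mw w0 WtE] WE M0 d0 wt0 dE.
have [L uL /= [DD DE LL Dlse]] := design_isometry rank_Phi.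
set D := Phi *m (invmx L)^T in DD DE Dlse.
pose B : 'M[R]_k := s *: (invmx L)^T.
have PB : Phi *m B = s *: D by rewrite /B -scalemxAr.
have uLT : (invmx L)^T \in unitmx by rewrite unitmx_tr unitmx_inv.
have uB : B \in unitmx.
  by rewrite unitmxE /B detZ unitrM -unitmxE uLT andbT unitrX// unitfE gt_eqF.
pose dB := `|\det B|.
have dB0 : 0 < dB by rewrite normr_gt0 -unitfE -unitmxE.
(* The density of z under theta = B z. *)
pose v z := dB * w (B *m z).
have mwB : measurable_fun setT (fun z : 'cV[R]_k => w (B *m z)).
  exact: (measurableT_comp mw (measurable_mulmx B)).
have mv : measurable_fun setT v by exact: measurable_funM.
have v0 z : 0 <= v z by rewrite mulr_ge0// ltW.
have WvE A : measurable A ->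
    (W A = \int[lebesgue k]_(z in mulmx (s *: D) @^-1` A) (v z)%:E)%E.
  move=> mA; rewrite WE// /pushforward WtE; last first.
    exact: (measurable_preimage (measurable_mulmx Phi) mA).
  rewrite integral_mkcond [RHS]integral_mkcond !epatch_indic.
  rewrite (integral_lebesgue_linear uB); last 2 first.
  - apply: emeasurable_funM; first exact/measurable_EFinP.
    apply/measurable_EFinP/measurable_indic.
    exact: (measurable_preimage (measurable_mulmx Phi) mA).
  - by move=> z; rewrite mule_ge0// lee_fin// indicE.
  rewrite -ge0_integralZl//; last 2 first.
  - apply: emeasurable_funM; first exact/measurable_EFinP.
    apply/measurable_EFinP; apply: (measurableT_comp (measurable_indic _)).
      exact: (measurable_preimage (measurable_mulmx Phi) mA).
    exact: measurable_mulmx.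
  - by move=> z _; rewrite mule_ge0// lee_fin// indicE.
  apply: eq_integral => z _ /=; rewrite muleA -EFinM !indic_preimage.
  by rewrite mulmxA PB.
have v1 : (\int[lebesgue k]_z (v z)%:E = 1)%E.
  by rewrite -(probability_setT W) WvE// preimage_setT.
pose x0 : 'cV[R]_k := s^-1 *: (D^T *m F0).
have Bx0 : B *m x0 = lse Phi F0.
  by rewrite /x0 /B -scalemxAr -scalemxAl scalerA mulVf ?gt_eqF// scale1r Dlse.
have c0 : 0 < dB * w (lse Phi F0) by rewrite mulr_gt0.
have := @integral_posterior_tv_le R n k p D v W s G K (dB * w (lse Phi F0)) DD s0
  c0 mv v0 WvE posteriorK F0.
rewrite DE -/risk => /le_trans; apply.
rewrite EFinM lee_wpmul2l// -/x0.
have loc z : sqn (z - x0) <= M -> `|v z / (dB * w (lse Phi F0)) - 1| <= d.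
  move=> zM; have -> : v z / (dB * w (lse Phi F0)) =
      w (lse Phi F0 + B *m (z - x0)) / w (lse Phi F0).
    rewrite /v invfM mulrACA divff ?gt_eqF// mul1r; congr (w _ / _).
    by rewrite mulmxBr Bx0 addrC subrK.
  apply: dE; rewrite mulmxA PB enorm_sqr -scalemxAl sqnZ ler_wpM2l ?sqr_ge0//.
  rewrite sqnE trmx_mul -mulmxA (mulmxA D^T) DD mul1mx -sqnE.
  exact: zM.
apply: le_trans (local_prior_oscillation mv v0 v1 c0 d0 loc) _.
rewrite lee_fin lerD2r lerD2l ler_wpM2r ?expR_ge0//.
rewrite le_eqVlt; apply/orP; left; apply/eqP.
(* Since det (Phi^T Phi) = (det L)^2; this identifies 1 / c with the argument of the logarithm in
   (3). *)
have -> : dB = s ^+ k / Num.sqrt (\det (Phi^T *m Phi)).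
  rewrite /dB /B detZ normrM gtr0_norm ?exprn_gt0//; congr (_ * _).
  rewrite det_tr det_inv normfV; congr (_^-1).
  by rewrite -LL det_mulmx det_tr -expr2 sqrtr_sqr.
by rewrite !invfM invrK mulrA [s ^- k * _]mulrC.
Qed.

End regression_bounds.

End finite_sample_bounds.

(** * Passage to the limit *)

Section limits.
Context {R : realType}.

Lemma ge0_cvge0 (X : nat -> \bar R) : (forall n, 0 <= X n)%E ->
  (forall e : R, 0 < e -> \forall n \near \oo, (X n <= e%:E)%E) ->
  X n @[n --> \oo] --> 0%E.
Proof.
move=> X0 Xe; apply/fine_cvgP; split.
  have := Xe 1 ltr01; apply: filterS => n Xn.
  by rewrite ge0_fin_numE// (le_lt_trans Xn)// ltry.
apply/cvgrPdist_le => e e0; have := Xe e e0; apply: filterS => n Xn /=.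
have := X0 n; move: Xn; case: (X n) => [r||]//=; rewrite !lee_fin => re r0.
by rewrite sub0r normrN ger0_norm.
Qed.

Lemma eqo_near (f g : nat -> R) (e : R) : f =o_\oo g -> 0 < e ->
  \forall n \near \oo, `|f n| <= e * `|g n|.
Proof. by move=> /eqoP fg e0; exact: fg. Qed.

Lemma expR_le1D2 (y : R) : 0 <= y -> y <= 2^-1 -> expR y <= 1 + 2 * y.
Proof.
move=> y0 y2; have h := expR_ge1Dx (- y).
rewrite -[expR y]invrK -expRN (@le_trans _ _ (1 - y)^-1)//.
  by rewrite lef_pV2// posrE ?expR_gt0//; lra.
rewrite -[leLHS]mul1r ler_pdivrMr; nra.
Qed.

(** From exp (1 / 2) <= 2. This crude value already gives k ln k >= 1 for k >= 2. *)
Lemma ln2_ge : 2^-1 <= ln (2 : R).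
Proof.
rewrite -[leLHS]expRK ler_ln ?posrE ?expR_gt0//.
by apply: le_trans (expR_le1D2 _ _) _; lra.
Qed.

(** The lower bound on the supremum yields one point of positive density; finiteness then spreads
    positivity to the whole ellipsoid, and comparing with the centre in both directions bounds the
    ratio. *)
Lemma sup_ratio_local n k (Phi : 'M[R]_(n, k)) (w : 'cV[R]_k -> R) t0 (r2 d : R) :
  (forall t, 0 <= w t) -> 0 <= r2 -> 0 <= d < 1 ->
  ((1 - d)%:E < sup_ratio Phi w t0 r2)%E -> (sup_ratio Phi w t0 r2 <= (1 + d)%:E)%E ->
  0 < w t0 /\ forall h, enorm (Phi *m h) ^+ 2 <= r2 -> `|w (t0 + h) / w t0 - 1| <= d.
Proof.
move=> w0 r20 /andP[d0 d1] lo hi.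
have in0 : enorm (Phi *m (0 : 'cV[R]_k)) ^+ 2 <= r2.
  rewrite enorm_sqr mulmx0 /sqn big1// => i _; by rewrite mxE expr0n.
have ratio h g : enorm (Phi *m h) ^+ 2 <= r2 -> enorm (Phi *m g) ^+ 2 <= r2 ->
    ((w (t0 + h))%:E / (w (t0 + g))%:E <= (1 + d)%:E)%E.
  move=> hr gr; apply: le_trans hi; apply: ereal_sup_ubound.
  by exists h, g.
have ratioR h g : enorm (Phi *m h) ^+ 2 <= r2 -> enorm (Phi *m g) ^+ 2 <= r2 ->
    0 < w (t0 + h) -> 0 < w (t0 + g) /\ w (t0 + h) <= (1 + d) * w (t0 + g).
  move=> hr gr wh; have := ratio _ _ hr gr; rewrite inver.
  case: eqP => [_|/eqP wg]; first by rewrite gt0_muley ?lte_fin// leye_eq.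
  have wg0 : 0 < w (t0 + g) by rewrite lt_def wg w0.
  by rewrite -EFinM lee_fin ler_pdivrMr.
(* Were [w] zero throughout, every ratio would be 0 / 0 = 0, below [1 - d]. *)
have [h hr wh] : exists2 h, enorm (Phi *m h) ^+ 2 <= r2 & 0 < w (t0 + h).
  apply: contrapT => no; move: lo; apply/negP; rewrite -leNgt.
  apply: ge_ereal_sup => _ [h [g [hr gr ->]]].
  have -> : w (t0 + h) = 0.
    apply/eqP; rewrite eq_le w0 andbT leNgt; apply/negP => wh.
    by apply: no; exists h.
  by rewrite mul0e lee_fin subr_ge0 ltW.
have [w00 _] := ratioR _ _ hr in0 wh; rewrite addr0 in w00.
split=> // g gr.
have [wg wle] : 0 < w (t0 + g) /\ w t0 <= (1 + d) * w (t0 + g).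
  by have := ratioR 0 g in0 gr; rewrite addr0; apply.
have [_ wge] := ratioR g 0 gr in0 wg; rewrite addr0 in wge.
rewrite ler_norml lerBrDr lerBlDr ler_pdivlMr// ler_pdivrMr// [d + 1]addrC wge andbT.
(* The lower bound 1 / (1 + d) on the ratio is weakened to 1 - d through (1 - d) (1 + d) <= 1. *)
have : (1 - d) * w t0 <= (1 - d) * ((1 + d) * w (t0 + g)).
  by rewrite ler_wpM2l// subr_ge0 ltW.
have : 0 <= d ^+ 2 * w (t0 + g) by rewrite mulr_ge0 ?sqr_ge0.
rewrite [- d + 1]addrC; lra.
Qed.

(** The hat matrix times its transpose is itself, as seen from its form D D^T with orthonormal
    columns. *)
Lemma gaussian_fitted n k p (Phi : 'M[R]_(n, k)) (s : R) (G : 'M[R]_(p, n))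
    (F : 'cV[R]_n) (B : set 'cV[R]_p) : \rank Phi = k -> measurable B ->
  pushforward (gaussian F (s ^+ 2)%:M) (fun y => G *m (hat Phi *m y)) B =
  gaussian (G *m (hat Phi *m F)) (s ^+ 2 *: (G *m hat Phi *m G^T)) B.
Proof.
move=> rk mB; have [L uL /= [DD DE _ _]] := design_isometry rk.
set D := Phi *m _ in DD DE; clearbody D.
have hh : hat Phi *m (hat Phi)^T = hat Phi.
  by rewrite -DE trmx_mul trmxK mulmxA -(mulmxA D) DD mulmx1.
pose A := G *m hat Phi.
have -> : s ^+ 2 *: (G *m hat Phi *m G^T) = (s *: A) *m (s *: A)^T.
  rewrite linearZ/= -scalemxAl -scalemxAr scalerA -expr2; congr (_ *: _).
  by rewrite /A trmx_mul [RHS]mulmxA -(mulmxA G (hat Phi) (hat Phi)^T) hh.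
have -> : (s ^+ 2)%:M = s%:M *m (s%:M)^T :> 'M[R]_n.
  by rewrite tr_scalar_mx -scalar_mxM expr2.
have mf : measurable_fun setT (fun y : 'cV[R]_n => G *m (hat Phi *m y)).
  exact: (measurableT_comp (measurable_mulmx G) (measurable_mulmx (hat Phi))).
rewrite /pushforward !gaussianE//; last exact: (measurable_preimage mf mB).
congr (std_normal n _); apply/funext => z /=.
rewrite /affine !mulmxDr mul_scalar_mx -!scalemxAr -scalemxAl /A.
by rewrite -mulmxA.
Qed.

Lemma posterior_risk_ge0 n p (K : R.-pker 'cV[R]_n ~> 'cV[R]_p) (P : probability 'cV[R]_n R)
    (m : 'cV[R]_n -> 'cV[R]_p) (C : 'M[R]_p) :
  (0 <= \int[P]_y tv_dist (K y) (gaussian (m y) C))%E.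
Proof.
apply: integral_ge0 => y _; apply: le_ereal_sup_tmp; exists 0%E => //.
by exists set0 => //; rewrite !measure0 sube0 abse0.
Qed.

Lemma near_ge1 : \forall n \near \oo, (1 <= n)%N.
Proof. by exists 1%N. Qed.

End limits.

Unset Implicit Arguments.
Set Strict Implicit.

Theorem corollary1 (R : realType) (p : nat) (k : nat -> nat) (sigma : nat -> R)
    (F0 : forall n, 'cV[R]_n) (Phi : forall n, 'M[R]_(n, k n))
    (G : forall n, 'M[R]_(p, n)) (W : forall n, probability 'cV[R]_n R)
    (K : forall n, R.-pker 'cV[R]_n ~> 'cV[R]_p)
    (p_ge1 : (1 <= p)%N)
    (k_bounds : forall n, (1 <= n)%N -> (1 <= k n <= n)%N)
    (k_grows : \forall n \near \oo, (2 <= k n)%N)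
    (sigma_gt0 : forall n, (1 <= n)%N -> 0 < sigma n)
    (rank_Phi : forall n, (1 <= n)%N -> \rank (Phi n) = k n)
    (posteriorK : forall n, (1 <= n)%N ->
       is_posterior (W n) (sigma n) (G n) (K n)) :
  (exists tau : nat -> R,
     [/\ forall n, (1 <= n)%N -> 0 < tau n,
         forall n, (1 <= n)%N -> forall A : set 'cV[R]_n, measurable A ->
           W n A = gaussian 0 (tau n ^+ 2 *: hat (Phi n)) A,
         sigma =o_\oo tau,
         (fun n => enorm (F0 n)) =o_\oo (fun n => tau n ^+ 2 / sigma n) &
         (fun n => (k n)%:R : R) =o_\oo (fun n => tau n ^+ 4 / sigma n ^+ 4)])
  \/
  (exists (Wt : forall n, probability 'cV[R]_(k n) R)
          (w : forall n, 'cV[R]_(k n) -> R) (M : nat -> R),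
     let theta0 n := lse (Phi n) (F0 n) in
     (forall n, (1 <= n)%N ->
        [/\ has_density (Wt n) (w n),
            forall A : set 'cV[R]_n, measurable A ->
              W n A = pushforward (Wt n) (mulmx (Phi n)) A &
            0 < M n]) /\
     [/\ sup_ratio (Phi n) (w n) (theta0 n) (sigma n ^+ 2 * M n) @[n --> \oo]
           --> 1%E,
         (fun n => (k n)%:R * ln ((k n)%:R : R)) =o_\oo M &
         (fun n => Num.max 0
            (ln (Num.sqrt (\det ((Phi n)^T *m Phi n)) /
                 (sigma n ^+ k n * w n (theta0 n))))) =o_\oo M]) ->
  (\int[gaussian (F0 n) (sigma n ^+ 2)%:M]_y
     tv_dist (K n y)
       (gaussian (G n *m (hat (Phi n) *m y))
                 (sigma n ^+ 2 *: (G n *m hat (Phi n) *m (G n)^T))))%E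
    @[n --> \oo] --> 0%E
  /\
  (forall n, (1 <= n)%N -> forall B : set 'cV[R]_p, measurable B ->
     pushforward (gaussian (F0 n) (sigma n ^+ 2)%:M)
       (fun y => G n *m (hat (Phi n) *m y)) B =
     gaussian (G n *m (hat (Phi n) *m F0 n))
       (sigma n ^+ 2 *: (G n *m hat (Phi n) *m (G n)^T)) B).
Proof.
move=> AB; split; last by move=> n n1 B mB; exact: gaussian_fitted (rank_Phi n n1) mB.
apply: ge0_cvge0 => [n|e e0]; first exact: posterior_risk_ge0.
case: AB => [[tau [tau0 WE _ F0o ko]]|[Wt [w [M /= [WtE [supo klnko maxo]]]]]].
(* With d = e / 4 the exponent y is at most [eta] <= 1 / 2, so exp y - 1 <= 2 eta <= (e / 4)^2 and
   the risk is at most 2 (e / 4 + e / 4) = e. *)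
- pose eta := Num.min 2^-1 (e ^+ 2 / 32).
  have eta0 : 0 < eta by rewrite lt_min invr_gt0 ltr0n divr_gt0// exprn_gt0.
  have [eta1 eta2] : eta <= 2^-1 /\ eta <= e ^+ 2 / 32.
    by rewrite /eta !ge_min !lexx orbT.
  have c0 : 0 < eta / 4 by rewrite divr_gt0.
  have := near_ge1; have := eqo_near ko c0; have := eqo_near F0o c0.
  apply: filterS3 => n F0n kn n1.
  have s0 := sigma_gt0 n n1; have t0 := tau0 n n1; have rk := rank_Phi n n1.
  have e4 : 0 < e / 4 by rewrite divr_gt0.
  have := gaussian_prior_risk (F0 n) rk s0 (posteriorK n n1) t0 e4 (WE n n1).
  move=> /= /le_trans; apply; rewrite lee_fin.
  set a := (k n)%:R * (sigma n / tau n) ^+ 4.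
  set q := sigma n / tau n ^+ 2 * enorm (F0 n).
  have a0 : 0 <= a by rewrite mulr_ge0// exprn_ge0// divr_ge0 ?ltW.
  have q0 : 0 <= q by rewrite mulr_ge0 ?sqrtr_ge0// divr_ge0 ?exprn_ge0 ?ltW.
  have a1 : a <= eta / 4.
    move: kn; rewrite ger0_norm// ger0_norm ?divr_ge0 ?exprn_ge0 ?(ltW s0) ?(ltW t0)//.
    rewrite -ler_pdivrMr ?divr_gt0 ?exprn_gt0// invf_div.
    by rewrite -expr_div_n.
  have q1 : q <= eta / 4.
    move: F0n; rewrite ger0_norm ?sqrtr_ge0//.
    rewrite ger0_norm ?divr_ge0 ?exprn_ge0 ?(ltW s0) ?(ltW t0)//.
    rewrite -ler_pdivrMr ?divr_gt0 ?exprn_gt0// invf_div.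
    by rewrite mulrC.
  have q2 : q ^+ 2 <= eta / 4 by nra.
  have yb : expR (2 * a + 2 * q ^+ 2) <= 1 + 2 * (2 * a + 2 * q ^+ 2).
    apply: expR_le1D2; last by lra.
    by rewrite addr_ge0// mulr_ge0// sqr_ge0.
  have : (expR (2 * a + 2 * q ^+ 2) - 1) / (e / 4) <= e / 4.
    rewrite ler_pdivrMr//; have -> : e / 4 * (e / 4) = e ^+ 2 / 16 by field.
    lra.
  lra.
(* Both exponential terms will be at most exp(- M / 16) <= 16 eps <= e / 8, for a total of 2 (e / 4
   + e / 8 + e / 8) = e. *)
- pose d := Num.min 2^-1 (e / 4); pose eps := Num.min 8^-1 (e / 128).
  have d0 : 0 < d by rewrite lt_min invr_gt0 ltr0n divr_gt0.
  have eps0 : 0 < eps by rewrite lt_min invr_gt0 ltr0n divr_gt0.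
  have [d1 d2] : d <= 2^-1 /\ d <= e / 4 by rewrite /d !ge_min !lexx orbT.
  have [eps1 eps2] : eps <= 8^-1 /\ eps <= e / 128.
    by rewrite /eps !ge_min !lexx orbT.
  have c8 : (0 < 8^-1 :> R) by [].
  have /fine_cvgP[supfin /cvgrPdist_lt/(_ d d0) supd] := supo.
  near=> n.
  have n1 : (1 <= n)%N by near: n; exact: near_ge1.
  have k2 : (2 <= k n)%N by near: n.
  have maxn : `|Num.max 0 (ln (Num.sqrt (\det ((Phi n)^T *m Phi n)) /
      (sigma n ^+ k n * w n (lse (Phi n) (F0 n)))))| <= 8^-1 * `|M n|.
    by near: n; exact: eqo_near maxo c8.
  have klnn : `|(k n)%:R * ln ((k n)%:R : R)| <= eps * `|M n|.
    by near: n; exact: eqo_near klnko eps0.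
  have supn : sup_ratio (Phi n) (w n) (lse (Phi n) (F0 n)) (sigma n ^+ 2 * M n)
    \is a fin_num by near: n.
  have supdn : `|1 - fine (sup_ratio (Phi n) (w n) (lse (Phi n) (F0 n))
    (sigma n ^+ 2 * M n))| < d by near: n.
  have s0 := sigma_gt0 n n1; have rk := rank_Phi n n1.
  have [dens WE M0] := WtE n n1.
  set th := lse (Phi n) (F0 n).
  have [lo hi] : ((1 - d)%:E < sup_ratio (Phi n) (w n) th (sigma n ^+ 2 * M n))%E /\
      (sup_ratio (Phi n) (w n) th (sigma n ^+ 2 * M n) <= (1 + d)%:E)%E.
    move: supn supdn; rewrite -/th.
    case: (sup_ratio _ _ _ _) => [r||]//= _ rd; rewrite lte_fin lee_fin.
    move: rd; rewrite ltr_norml => /andP[? ?]; split; lra.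
  have [wt0 loc] : 0 < w n th /\ forall h,
      enorm (Phi n *m h) ^+ 2 <= sigma n ^+ 2 * M n ->
      `|w n (th + h) / w n th - 1| <= d.
    apply: sup_ratio_local lo hi; first by case: dens.
      by rewrite mulr_ge0 ?sqr_ge0// ltW.
    by rewrite ltW//=; lra.
  have := smooth_prior_risk rk s0 (posteriorK n n1) dens WE M0 (ltW d0) wt0 loc.
  move=> /le_trans; apply; rewrite lee_fin -/th.
  set X := Num.sqrt _ / _.
  have X0 : 0 < X.
    rewrite divr_gt0 ?mulr_gt0 ?exprn_gt0// sqrtr_gt0.
    have [L uL [_ _ LL _]] := design_isometry rk.
    rewrite -LL det_mulmx det_tr -expr2 exprn_even_gt0//= -unitfE.
    by rewrite -unitmxE.
  have M8 : Num.max 0 (ln X) <= 8^-1 * M n.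
    move: maxn; rewrite -/th -/X (ger0_norm (ltW M0)); apply: le_trans; exact: ler_norm.
  have kM : (k n)%:R * ln ((k n)%:R : R) <= eps * M n.
    move: klnn; rewrite (ger0_norm (ltW M0)); apply: le_trans; exact: ler_norm.
  have k2R : 2 <= (k n)%:R :> R by rewrite (ler_nat R 2).
  have lnk : ln 2 <= ln ((k n)%:R : R) by rewrite ler_ln// posrE; lra.
  have ln2 := @ln2_ge R.
  (* Here k >= 2 enters: k ln k >= 2 ln 2 >= 1, so [M n] is at least 1 / eps. *)
  have epsM : 1 <= eps * M n by nra.
  have X1 : X <= expR (M n / 8).
    rewrite -[X]lnK// ler_expR; apply: (@le_trans _ _ (Num.max 0 (ln X))).
      by rewrite le_max lexx orbT.
    by rewrite mulrC.
  have XE : X * expR (- (M n / 4)) <= expR (- (M n / 16)).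
    apply: (@le_trans _ _ (expR (M n / 8) * expR (- (M n / 4)))).
      by rewrite ler_wpM2r ?expR_ge0.
    by rewrite -expRD ler_expR; lra.
  have SE : Num.sqrt 2 ^+ k n * expR (- (M n / 8)) <= expR (- (M n / 16)).
    apply: (@le_trans _ _ (expR (M n / 16) * expR (- (M n / 8)))).
      rewrite ler_wpM2r ?expR_ge0//.
      (* sqrt 2 <= sqrt k, and the [k]-th power is exp(k ln k / 2) <= exp(eps M / 2) <= exp(M / 16)
         because eps <= 1 / 8. *)
      apply: (@le_trans _ _ (expR (ln (k n)%:R / 2) ^+ k n)).
        rewrite lerXn2r ?nnegrE ?sqrtr_ge0 ?expR_ge0//.
        rewrite -ler_sqr ?nnegrE ?sqrtr_ge0 ?expR_ge0// sqr_sqrtr//.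
        rewrite -expRM_natl mulrC divfK// lnK// posrE; lra.
      rewrite -expRM_natl ler_expR; nra.
    by rewrite -expRD ler_expR; lra.
  (* From exp(M / 16) >= M / 16 >= 1 / (16 eps). *)
  have E16 : expR (- (M n / 16)) <= 16 * eps.
    rewrite expRN -[leRHS]invrK lef_pV2 ?posrE ?expR_gt0 ?invr_gt0 ?mulr_gt0//.
    apply: (@le_trans _ _ (M n / 16)).
      rewrite -div1r ler_pdivrMr ?mulr_gt0//.
      by rewrite (_ : M n / 16 * (16 * eps) = eps * M n)//; field.
    by have := expR_ge1Dx (M n / 16); lra.
  lra.
Unshelve. all: by end_near.
Qed.
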